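(* Let $k>0$, $I>0$, $0<A_1\le A_2\le A_3$, $J=\mathrm{diag}(A_1,A_2,A_3)$, and consider the system of ODEs for $(\Omega,\Omega_1)\in\mathbb{R}^3\times\mathbb{R}^3$ $$\dot\Omega=J^{-1}\big(k(\Omega_1-\Omega)-\Omega\times(J\Omega)\big),\qquad \dot\Omega_1=-\frac{k}{I}(\Omega_1-\Omega)-\Omega\times\Omega_1 .$$ All solutions converge to an equilibrium with an exponential rate. More precisely, for every $(\Omega_0,\Omega_{10})\in\mathbb{R}^3\times\mathbb{R}^3$ there exist $t^*\ge0$ and $(\Omega^*,\Omega_1^* )\in\mathcal{E}$ such that the unique solution $(\Omega(t),\Omega_1(t))$ of the system with $(\Omega(0),\Omega_1(0))=(\Omega_0,\Omega_{10})$ exists for all $t\ge0$ and satisfies $$\|\Omega(t)-\Omega^*\|+\|\Omega_1(t)-\Omega^*\|\le Ce^{-ct}\qquad\text{for all }t\ge t^*,$$ where $C$ and $c$ are positive constants.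
   Context: Here $\times$ is the cross product in $\mathbb{R}^3$ and $\|\cdot\|$ the Euclidean norm. $\mathcal{E}\subset\mathbb{R}^3\times\mathbb{R}^3$ denotes the set of equilibrium points of the system (zeros of its right-hand side); it consists exactly of the points $(\Omega^*,\Omega_1^* )$ with $\Omega^*=\Omega_1^*$ and $\Omega^*$ either the zero vector or an eigenvector of $J$ (so that the limit motion is a permanent rotation about a principal axis of inertia). The constants $C,c$ may depend on the solution. *)

(* Defs.v *)
From HB Require Import structures.
From mathcomp Require Import all_boot all_order all_algebra.
From mathcomp Require Import all_classical all_reals all_analysis.

Set Implicit Arguments.
Unset Strict Implicit.
Unset Printing Implicit Defensive.

Import Order.TTheory GRing.Theory Num.Theory.
Import numFieldNormedType.Exports.

Local Open Scope classical_set_scope.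
Local Open Scope ring_scope.

(* The library norm `|_| on matrices is the sup norm, hence a separate
   Euclidean norm; both induce the same topology. *)
Definition enorm (R : realType) (u : 'cV[R]_3) : R :=
  Num.sqrt (\sum_(i < 3) u i 0 ^+ 2).

Definition crossmul (R : realType) (u v : 'cV[R]_3) : 'cV[R]_3 :=
  \col_(i < 3) [:: u 1 0 * v 2 0 - u 2 0 * v 1 0;
                   u 2 0 * v 0 0 - u 0 0 * v 2 0;
                   u 0 0 * v 1 0 - u 1 0 * v 0 0]`_i.

Definition inertia (R : realType) (A1 A2 A3 : R) : 'M[R]_3 :=
  diag_mx (\row_(i < 3) [:: A1; A2; A3]`_i).

(* Right-hand side of the system at the state x = (Omega, Omega_1). *)
Definition vfield (R : realType) (k I : R) (J : 'M[R]_3)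
    (x : 'cV[R]_3 * 'cV[R]_3) : 'cV[R]_3 * 'cV[R]_3 :=
  (invmx J *m (k *: (x.2 - x.1) - crossmul x.1 (J *m x.1)),
   - (k / I) *: (x.2 - x.1) - crossmul x.1 x.2).

Definition equilibria (R : realType) (k I : R) (J : 'M[R]_3) :
    set ('cV[R]_3 * 'cV[R]_3) :=
  [set x | vfield k I J x = 0].

(* Derivative relative to D: one-sided at an endpoint of an interval D, and
   independent of the values of f outside D when t is in D. *)
Definition has_derivative_within (R : realType) (V : normedModType R)
    (D : set R) (f : R -> V) (t : R) (v : V) : Prop :=
  (s - t)^-1 *: (f s - f t) @[s --> within D t^'] --> v.

Definition is_solution (R : realType) (k I : R) (J : 'M[R]_3)
    (x0 : 'cV[R]_3 * 'cV[R]_3) (D : set R)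
    (x : R -> 'cV[R]_3 * 'cV[R]_3) : Prop :=
  x 0 = x0 /\
  forall t, D t -> has_derivative_within D x t (vfield k I J (x t)).

(* Main.v *)
Require Import Defs.
From HB Require Import structures.
From mathcomp Require Import all_boot all_order all_algebra.
From mathcomp Require Import all_classical all_reals all_analysis.
From mathcomp Require Import ring lra.

Set Implicit Arguments.
Unset Strict Implicit.
Unset Printing Implicit Defensive.

Import Order.TTheory GRing.Theory Num.Theory.
Import numFieldNormedType.Exports.

Local Open Scope classical_set_scope.
Local Open Scope ring_scope.

(** Write z = Omega_1 - Omega for the slip between damper and body,
M = J Omega + I Omega_1 for the total angular momentum and q = Omega x M.
The system says that M' = - q; hence |M| is constant, and twice the kinetic
energy, E = Omega . J Omega + I |Omega_1|^2, satisfies E' = - 2 k |z|^2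
(energy_rate). The equilibria are the states with z = 0 and q = 0, and every
rate in the system is O(|z| + |q|) along a bounded trajectory (rate_bounds).

The energy does not see q, but z' equals J^-1 q up to a term of order z.
Subtracting a small multiple of z . q therefore produces a function
H = E - e (z . q) with H' <= - c0 S, where S = |z|^2 + |q|^2
(trajectory_lyapunov).

The limit of a trajectory may be a saddle, or a point of a continuum of
equilibria when two moments of inertia coincide; linearization alone does not
settle these cases.
A Lojasiewicz inequality with exponent 1/2 covers all of them at once:
E = F + O(|z|^2), where F is the value at M of the quadratic form with matrix
B = (J + I)^-1, and on a sphere every number h satisfies
|F - h| <= C |M x B M|^2 as soon as F is close to h
(quadratic_form_lojasiewicz); moreover M x B M = - q + O(|z|). Hence
H - h <= kappa S whenever H is close to h, critical value or not.

Take h to be the limit of the decreasing function H. Then W = H - h >= 0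
eventually satisfies W' <= - c0 S <= - (c0 / kappa) W, so that W decays
exponentially. Every coordinate u has |u'| <= K sqrt S, and sqrt S is bounded
by minus the derivative of an exponentially small function built from W; so u
converges exponentially (exponential_convergence). Arbitrarily late S is
arbitrarily small (dissipation_small), hence the right-hand side vanishes at
the limit, and by energy_rate an equilibrium has zero slip.

Global existence and uniqueness use the same energy. A locally Lipschitz field f
with x . f(x) <= 0 for a weighted scalar product becomes globally Lipschitz, and
stays dissipative, when composed with the radial retraction onto a ball; Picard
iteration solves the retracted equation for all times (lipschitz_ode), and the
energy keeps its solution inside the ball, where both equations agree
(dissipative_ode_exists). *)

(** * Calculus on a half line *)

(** Completeness of the reals in the form used for both limits below, that of
the Picard iterates and that of the trajectory: the limit is pinned between a
family of lower and a family of upper bounds, without sequences or filters. *)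
Lemma separation_point (R : realType) (T : Type) (t0 : T) (a b : T -> R) :
  (forall s t, a s <= b t) -> exists l, forall t, a t <= l <= b t.
Proof.
move=> ab; exists (sup (range a)) => t; apply/andP; split.
- apply: ub_le_sup; last by exists t.
  by exists (b t0) => _ [s _ <-].
- apply: ge_sup; first by exists (a t0), t0.
  by move=> _ [s _ <-].
Qed.

Lemma nonincreasing_of_derive (R : realType) (u du : R -> R) (s t : R) :
  s <= t ->
  (forall x, s <= x <= t -> is_derive x 1 u (du x)) ->
  (forall x, s <= x <= t -> du x <= 0) -> u t <= u s.
Proof.
move=> st du_u du_le0.
have sub x : x \in `]s, t[ -> s <= x <= t.
  by rewrite in_itv /= => /andP[/ltW -> /ltW ->].
have cont : {within `[s, t], continuous u}.
  apply: derivable_within_continuous => x; rewrite in_itv /= => xst.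
  by have [] := du_u x xst.
have der x : x \in `]s, t[ -> derivable u x 1 by move/sub/du_u => [].
have der_le0 x : x \in `]s, t[ -> derive1 u x <= 0.
  by move/sub => xst; have [_ dE] := du_u x xst; rewrite derive1E dE du_le0.
apply: (ler0_derive1_le_cc der der_le0 cont) => //;
  by rewrite in_itv /= lexx ?andbT.
Qed.

(** Stands in for bounding an integral: the estimates below never integrate an
inequality, they exhibit a function w whose derivative dominates. *)
Lemma increment_le_of_derive_le (R : realType) (u du w dw : R -> R) (s t : R) :
  s <= t ->
  (forall x, s <= x <= t -> is_derive x 1 u (du x)) ->
  (forall x, s <= x <= t -> is_derive x 1 w (dw x)) ->
  (forall x, s <= x <= t -> `|du x| <= dw x) ->
  `|u t - u s| <= w t - w s.
Proof.
move=> st hu hw le.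
have h1 : u t - w t <= u s - w s.
  apply: (nonincreasing_of_derive (u := u - w) (du := fun x => du x - dw x)
            st) => x xst.
  - by have := hu x xst; have := hw x xst => *; exact: is_deriveB.
  - by have := le x xst; rewrite ler_norml => /andP[_]; lra.
have h2 : - u t - w t <= - u s - w s.
  apply: (nonincreasing_of_derive (u := - u - w) (du := fun x => - du x - dw x)
            st) => x xst.
  - by have := hu x xst; have := hw x xst => *; exact: is_deriveB.
  - by have := le x xst; rewrite ler_norml => /andP[]; lra.
by rewrite ler_norml; apply/andP; split; lra.
Qed.

Lemma is_derive_expRM (R : realType) (c t : R) :
  is_derive t 1 (fun s => expR (c * s)) (c * expR (c * t)).
Proof.
have h : is_derive t 1 ( *%R c) (c * 1) by exact: is_deriveZ.
rewrite (_ : (fun s => _) = expR \o ( *%R c)) //.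
by apply: is_derive_eq; rewrite mulr1 mulrC.
Qed.

(** The integral starts at -1 so that 0 is an interior point of its domain and
the derivative at 0 is two-sided. *)
Lemma antiderivative (R : realType) (f : R -> R) : continuous f ->
  let F (t : R) : R := (\int[@lebesgue_measure R]_(s in `[(-1), t]) f s)%R in
  forall t : R, 0 <= t -> is_derive t 1 F (f t).
Proof.
move=> cf F t t0.
have t1 : t < t + 1 by rewrite ltrDl.
have [|||dF FE] := @continuous_FTC1_closed _ f (-1) t (t + 1) t1.
- apply: continuous_compact_integrable; first exact: segment_compact.
  exact: continuous_subspaceT.
- lra.
- exact: cf.
by apply: DeriveDef; [exact: dF|rewrite -derive1E FE].
Qed.

Lemma le_of_geometric_error (R : realType) (a b C : R) :
  (forall n, a <= b + C * 2^-1 ^+ n) -> a <= b.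
Proof.
move=> h; rewrite leNgt; apply/negP => ba.
have := @cvg_expr R 2^-1.
have -> : `|2^-1 : R| < 1 by rewrite ger0_norm; lra.
move=> /(_ isT) /cvgrPdist_lt /(_ ((a - b) / (`|C| + 1))).
have C1 : 0 < `|C| + 1 by rewrite ltr_wpDl.
rewrite divr_gt0 ?subr_gt0 // => /(_ isT)[N _] /(_ N (leqnn N)) /=.
rewrite sub0r normrN ger0_norm ?exprn_ge0 // ltr_pdivlMr //.
have := h N; set e := _ ^+ N => hN.
have e0 : 0 <= e by rewrite exprn_ge0.
have := ler_norm C; move=> hC.
have : C * e <= `|C| * e by exact: ler_wpM2r.
nra.
Qed.

(** * Column vectors with the sup norm *)

Lemma normcv_coord (R : realType) n (u : 'cV[R]_n) i : `|u i 0| <= `|u|.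
Proof.
rewrite [leRHS]/Num.Def.normr /= mx_normrE.
exact: (le_bigmax _ (fun ij => `|u ij.1 ij.2|) (i, 0)).
Qed.

Lemma normcv_coordB (R : realType) n (u v : 'cV[R]_n) i :
  `|u i 0 - v i 0| <= `|u - v|.
Proof. by have := normcv_coord (u - v) i; rewrite !mxE. Qed.

Lemma normcv_le (R : realType) n (u : 'cV[R]_n) c :
  0 <= c -> (forall i, `|u i 0| <= c) -> `|u| <= c.
Proof.
move=> c0 uc; rewrite [leLHS]/Num.Def.normr /= mx_normrE.
by apply: bigmax_le => // -[i j] _ /=; rewrite (ord1 j).
Qed.

Lemma sqr_normcv_le (R : realType) n (u : 'cV[R]_n) :
  `|u| ^+ 2 <= \sum_i u i 0 ^+ 2.
Proof.
have sum0 : 0 <= \sum_i u i 0 ^+ 2 by apply: sumr_ge0 => i _; exact: sqr_ge0.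
rewrite -[leRHS]sqr_sqrtr // ler_pXn2r ?nnegrE ?sqrtr_ge0 //.
apply: normcv_le => [|i]; first exact: sqrtr_ge0.
rewrite -sqrtr_sqr ler_wsqrtr // (bigD1 i) //= lerDl.
by apply: sumr_ge0 => j _; exact: sqr_ge0.
Qed.

(** Coordinatewise, because the rules for sums and products of real functions
then apply directly, and the fundamental theorem of calculus is about real
functions. *)
Definition coord_derive (R : realType) n (u : R -> 'cV[R]_n) (t : R)
    (du : 'cV[R]_n) : Prop :=
  forall i, is_derive t 1 (fun s => u s i 0) (du i 0).

Lemma coord_deriveB (R : realType) n (u v : R -> 'cV[R]_n) t du dv :
  coord_derive u t du -> coord_derive v t dv ->
  coord_derive (fun s => u s - v s) t (du - dv).
Proof.
move=> hu hv i; have := hu i; have := hv i => *.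
rewrite !mxE (_ : (fun s => _) = (fun s => u s i 0) - (fun s => v s i 0)).
  exact: is_deriveB.
by apply/funext => s /=; rewrite !mxE.
Qed.

Lemma coord_deriveD (R : realType) n (u v : R -> 'cV[R]_n) t du dv :
  coord_derive u t du -> coord_derive v t dv ->
  coord_derive (fun s => u s + v s) t (du + dv).
Proof.
move=> hu hv i; have h1 := hu i; have h2 := hv i.
rewrite mxE (_ : (fun s => _) = (fun s => u s i 0) + (fun s => v s i 0)).
  exact: is_deriveD.
by apply/funext => s /=; rewrite mxE.
Qed.

Lemma coord_deriveZ (R : realType) n c (u : R -> 'cV[R]_n) t du :
  coord_derive u t du -> coord_derive (fun s => c *: u s) t (c *: du).
Proof.
move=> hu i; have h1 := hu i.
rewrite mxE (_ : (fun s => _) = c \*: (fun s => u s i 0)).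
  exact: is_deriveZ.
by apply/funext => s /=; rewrite mxE.
Qed.

Lemma norm_increment_le (R : realType) n (u du : R -> 'cV[R]_n)
    (w dw : R -> R) (s t : R) :
  s <= t ->
  (forall x, s <= x <= t -> coord_derive u x (du x)) ->
  (forall x, s <= x <= t -> is_derive x 1 w (dw x)) ->
  (forall x, s <= x <= t -> `|du x| <= dw x) ->
  `|u t - u s| <= w t - w s.
Proof.
move=> st hu hw le.
have coord i : `|u t i 0 - u s i 0| <= w t - w s.
  apply: (increment_le_of_derive_le (u := fun x => u x i 0)
            (du := fun x => du x i 0) (dw := dw) st) => // x xst.
    exact: hu.
  exact: le_trans (normcv_coord _ _) (le x xst).
apply: normcv_le => [|i]; last by rewrite !mxE.
rewrite subr_ge0 -lerN2.
apply: (nonincreasing_of_derive (u := - w) (du := fun x => - dw x) st) => x xst.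
  by have := hw x xst => *; exact: is_deriveN.
by rewrite oppr_le0; apply: le_trans (le x xst).
Qed.

(** * Global solutions of Lipschitz equations *)

Definition lipschitz_with (R : realType) m n (K : R)
    (f : 'cV[R]_m -> 'cV[R]_n) : Prop :=
  forall u v, `|f u - f v| <= K * `|u - v|.

(** The integrand is frozen at its value at time 0 for negative times. It is
then continuous on the whole line although y is only controlled for nonnegative
times, and the primitive has a two-sided derivative at 0. *)
Definition clamped_primitive (R : realType) n (f : 'cV[R]_n -> 'cV[R]_n)
    (y : R -> 'cV[R]_n) (i : 'I_n) (t : R) : R :=
  (\int[@lebesgue_measure R]_(s in `[(-1), t]) f (y (Num.max 0 s)) i 0)%R.

Definition picard (R : realType) n (f : 'cV[R]_n -> 'cV[R]_n) (x0 : 'cV[R]_n)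
    (y : R -> 'cV[R]_n) (t : R) : 'cV[R]_n :=
  x0 + \col_i (clamped_primitive f y i t - clamped_primitive f y i 0).

Section Picard.
Variables (R : realType) (n : nat) (f : 'cV[R]_n -> 'cV[R]_n) (K : R).
Hypotheses (K0 : 0 < K) (fK : lipschitz_with K f).
Variable x0 : 'cV[R]_n.

(** For 0 <= t every iteration gains a factor 1/2 in the norm weighted by
exp(-2Kt), on the whole half line at once: the derivative of the weight
exp(2Kt) is twice the Lipschitz factor K times the weight. The constant B makes
B * E a bound for the first step. *)
Let E (t : R) : R := expR (2 * K * t).
Let B : R := `|f x0| / (2 * K).

(** This modulus of continuity is preserved by the Picard operator and by
pointwise limits, so it provides the continuity that the limit needs in order
to be integrated. *)
Let tame (y : R -> 'cV[R]_n) : Prop :=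
  y 0 = x0 /\
  forall s t : R, 0 <= s -> s <= t -> `|y t - y s| <= 2 * B * E t - 2 * B * E s.

Let B_ge0 : 0 <= B. Proof. by rewrite divr_ge0 // mulr_ge0 // ltW. Qed.

Let BK : B * (2 * K) = `|f x0|.
Proof. by rewrite divfK // mulf_neq0 // ?lt0r_neq0. Qed.

Let E_gt0 t : 0 < E t. Proof. exact: expR_gt0. Qed.

Let E_ge1 t : 0 <= t -> 1 <= E t.
Proof. by move=> t0; rewrite -expR0 ler_expR !mulr_ge0 // ltW. Qed.

Let cE_ge0 c t : 0 <= c -> 0 <= c * E t.
Proof. by move=> c0; apply: mulr_ge0 => //; exact: ltW. Qed.

Let Bk_ge0 k : 0 <= B * 2^-1 ^+ k.
Proof. by rewrite mulr_ge0 // exprn_ge0. Qed.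

Let E_derive (c t : R) : is_derive t 1 (fun s => c * E s) (c * (2 * K * E t)).
Proof.
have hE : is_derive t 1 E (2 * K * E t) by exact: is_derive_expRM.
by rewrite (_ : (fun s => _) = c \*: E) //; exact: is_deriveZ.
Qed.

Let clamped_continuous y i : tame y ->
  continuous (fun s : R => f (y (Num.max 0 s)) i 0).
Proof.
move=> [_ ty] t.
have cE : continuous (fun s : R => K * (2 * B * E (Num.max 0 s))).
  move=> s; apply: cvgM; first exact: cvg_cst.
  apply: cvgM; first exact: cvg_cst.
  apply: (@continuous_comp _ _ _ (fun s : R => 2 * K * Num.max 0 s) expR);
    last exact: continuous_expR.
  apply: cvgM; first exact: cvg_cst.
  by apply: (@continuous_max _ _ (cst 0) id); [exact: cvg_cst|exact: cvg_id].
apply/cvgrPdist_le => e e0; have /cvgrPdist_le/(_ e e0) := cE t.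
apply: filterS => s; apply: le_trans.
have max0 (r : R) : 0 <= Num.max 0 r by rewrite le_max lexx.
have key a b : 0 <= a -> a <= b ->
    `|f (y b) i 0 - f (y a) i 0| <= `|K * (2 * B * E b) - K * (2 * B * E a)|.
  move=> a0 ab; apply: (@le_trans _ _ `|f (y b) - f (y a)|).
    exact: normcv_coordB.
  apply: le_trans (fK _ _) _; rewrite -mulrBr normrM (gtr0_norm K0).
  rewrite ler_pM2l //; apply: le_trans (ty _ _ a0 ab) _; exact: ler_norm.
have [ts|/ltW st] := leP (Num.max 0 t) (Num.max 0 s); last exact: key.
by rewrite distrC [leRHS]distrC; exact: key.
Qed.

Let picardP y : tame y -> picard f x0 y 0 = x0 /\
  forall t, 0 <= t -> coord_derive (picard f x0 y) t (f (y t)).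
Proof.
move=> ty; split=> [|t t0 i].
  by apply/colP => i; rewrite !mxE subrr addr0.
have hF := antiderivative (clamped_continuous (i := i) ty) t0.
rewrite /= (max_r t0) -/(clamped_primitive f y i) in hF.
pose F := clamped_primitive f y i.
rewrite (_ : (fun s => _) = F + cst (x0 i 0 - F 0)).
  by apply: is_derive_eq; rewrite addr0.
by apply/funext => s; rewrite !mxE; exact: addrCA.
Qed.

Let tame_dist y t : tame y -> 0 <= t -> `|y t - x0| <= 2 * B * E t.
Proof.
move=> [y0 ty] t0; rewrite -y0; apply: le_trans (ty _ _ (lexx _) t0) _.
by rewrite gerBl; apply: cE_ge0; exact: mulr_ge0.
Qed.

Let picard_tame y : tame y -> tame (picard f x0 y).
Proof.
move=> ty; have [P0 dP] := picardP ty; split=> // s t s0 st.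
apply: (@norm_increment_le _ _ _ (fun x => f (y x)) (fun x => 2 * B * E x)
          (fun x => 2 * B * (2 * K * E x))) => // x /andP[sx xt];
  have x_ge0 : 0 <= x by exact: le_trans sx.
  exact: dP.
have := fK (y x) x0; have := tame_dist ty x_ge0; have := E_ge1 x_ge0.
have := ler_normD (f (y x) - f x0) (f x0); rewrite subrK.
have := BK; have := normr_ge0 (f x0).
set d := `|y x - x0|; set a := `|f x0|; move=> a0 aE h E1 hd hf.
have : K * d <= K * (2 * B * E x) by rewrite ler_pM2l.
have : a * 1 <= a * E x by rewrite ler_wpM2l.
by rewrite -aE; lra.
Qed.

Let iterates k := iter k (picard f x0) (fun=> x0).

Let iterates_tame k : tame (iterates k).
Proof.
elim: k => [|k IH]; last exact: picard_tame.
split=> // s t s0 st; rewrite subrr normr0 subr_ge0.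
apply: ler_wpM2l; first exact: mulr_ge0.
by rewrite ler_expR ler_pM2l // mulr_gt0.
Qed.

Let iterates_derive k t : 0 <= t ->
  coord_derive (iterates k.+1) t (f (iterates k t)).
Proof. exact: (picardP (iterates_tame k)).2. Qed.

Let iterates_dist k t : 0 <= t ->
  `|iterates k.+1 t - iterates k t| <= B * 2^-1 ^+ k * E t.
Proof.
have tame0 := fun j => (iterates_tame j).1.
elim: k t => [|k IH] t t0.
  have := (@norm_increment_le _ _ (iterates 1) (fun=> f x0) (fun x => B * E x)
          (fun x => B * (2 * K * E x)) 0 t t0).
  rewrite tame0 expr0 mulr1 /= => h; apply: (le_trans (h _ _ _)) => //.
  - by move=> x /andP[x_ge0 _]; exact: (iterates_derive 0).
  - move=> x /andP[/E_ge1 E1 _]; rewrite mulrA BK.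
    by rewrite ler_peMr.
  - by rewrite gerBl; exact: cE_ge0.
have := (@norm_increment_le _ _ (fun x => iterates k.+2 x - iterates k.+1 x)
          (fun x => f (iterates k.+1 x) - f (iterates k x))
          (fun x => B * 2^-1 ^+ k.+1 * E x)
          (fun x => B * 2^-1 ^+ k.+1 * (2 * K * E x)) 0 t t0).
rewrite !tame0 subrr subr0 => h; apply: (le_trans (h _ _ _)) => //.
- by move=> x /andP[x_ge0 _]; apply: coord_deriveB; exact: iterates_derive.
- move=> x /andP[/IH hx _]; apply: le_trans (fK _ _) _.
  have : K * `|iterates k.+1 x - iterates k x| <= K * (B * 2^-1 ^+ k * E x).
    by rewrite ler_pM2l.
  move/le_trans; apply.
  by rewrite exprS le_eqVlt; apply/orP; left; apply/eqP; field.
- by rewrite gerBl; exact: cE_ge0.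
Qed.

Let limit_exists t : exists v : 'cV[R]_n, 0 <= t ->
  forall k, `|iterates k t - v| <= 2 * B * E t * 2^-1 ^+ k.
Proof.
have [t0|tN] := leP 0 t; last by exists 0.
pose C := 2 * B * E t.
have C0 : 0 <= C by apply: cE_ge0; exact: mulr_ge0.
suff /choice[l hl] : forall i : 'I_n, exists l, forall k,
    iterates k t i 0 - C * 2^-1 ^+ k <= l <= iterates k t i 0 + C * 2^-1 ^+ k.
  exists (\col_i l i) => _ k; apply: normcv_le => [|i].
    by rewrite mulr_ge0 // exprn_ge0.
  by rewrite !mxE ler_norml; have /andP[] := hl i k; rewrite -/C; lra.
move=> i; pose y k := iterates k t i 0; pose p k : R := 2^-1 ^+ k.
have step k : `|y k.+1 - y k| <= C * p k.+1.
  apply: le_trans (normcv_coordB _ _ i) _.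
  apply: le_trans (iterates_dist k t0) _.
  by rewrite /C /p exprS le_eqVlt; apply/orP; left; apply/eqP; field.
have pS k : p k = 2 * p k.+1 by rewrite /p exprS; field.
have p0 k : 0 <= p k by rewrite exprn_ge0.
(* y - C p increases and y + C p decreases *)
have lo j k : y j - C * p j <= y (j + k)%N - C * p (j + k)%N.
  elim: k => [|k IH]; first by rewrite addn0.
  apply: le_trans IH _; rewrite addnS pS.
  by have := step (j + k)%N; rewrite ler_norml => /andP[]; lra.
have hi j k : y (j + k)%N + C * p (j + k)%N <= y j + C * p j.
  elim: k => [|k IH]; first by rewrite addn0.
  apply: le_trans IH; rewrite addnS [X in _ <= _ + _ * X]pS.
  by have := step (j + k)%N; rewrite ler_norml => /andP[]; lra.
apply: (separation_point 0%N) => j k.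
have := lo j k; have := hi k j; rewrite addnC.
have : 0 <= C * p (j + k)%N by rewrite mulr_ge0.
rewrite /y /p; lra.
Qed.

(** The pointwise limit x of the iterates is tame, so its Picard image X is
defined; X is within a multiple of 2^-k of the (k+1)-st iterate, hence equals
x. As X is an antiderivative of f along x, it solves the equation. *)
Lemma lipschitz_ode : exists x : R -> 'cV[R]_n,
  x 0 = x0 /\ forall t, 0 <= t -> coord_derive x t (f (x t)).
Proof.
have /choice[x hx] := limit_exists.
have tx : tame x.
  split.
    apply/eqP; rewrite -subr_eq0 -normr_eq0 eq_le normr_ge0 andbT.
    apply: (@le_of_geometric_error _ _ _ (2 * B * E 0)) => k.
    by rewrite add0r distrC -[x0](iterates_tame k).1; exact: hx.
  move=> s t s0 st; have t0 := le_trans s0 st.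
  apply: (@le_of_geometric_error _ _ _ (2 * B * E s + 2 * B * E t)) => k.
  have := (iterates_tame k).2 s t s0 st; have := hx s s0 k; have := hx t t0 k.
  have := ler_distD (iterates k t) (x t) (x s).
  have := ler_distD (iterates k s) (iterates k t) (x s).
  rewrite (distrC (x t) (iterates k t)); lra.
have [X0 dX] := picardP tx; exists (picard f x0 x); split=> // t t0.
suff -> : picard f x0 x t = x t by exact: dX.
apply/eqP; rewrite -subr_eq0 -normr_eq0 eq_le normr_ge0 andbT.
apply: (@le_of_geometric_error _ _ _ (2 * B * E t)) => k; rewrite add0r.
have := (@norm_increment_le _ _ (fun r => picard f x0 x r - iterates k.+1 r)
          (fun r => f (x r) - f (iterates k r))
          (fun r => B * 2^-1 ^+ k * E r)
          (fun r => B * 2^-1 ^+ k * (2 * K * E r)) 0 t t0).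
rewrite X0 (iterates_tame _).1 subrr subr0 => h.
have : `|picard f x0 x t - iterates k.+1 t| <=
       B * 2^-1 ^+ k * E t - B * 2^-1 ^+ k * E 0.
  apply: h => // r /andP[r0 _].
  - by apply: coord_deriveB; [exact: dX|exact: iterates_derive].
  - apply: le_trans (fK _ _) _; rewrite distrC.
    have : K * `|iterates k r - x r| <= K * (2 * B * E r * 2^-1 ^+ k).
      by rewrite ler_pM2l //; exact: hx.
    by move/le_trans; apply; rewrite le_eqVlt; apply/orP; left; apply/eqP; ring.
have := hx t t0 k.+1.
have := ler_distD (iterates k.+1 t) (picard f x0 x t) (x t).
have : 0 <= B * 2^-1 ^+ k * E 0 by exact: cE_ge0.
rewrite exprS; set p := 2^-1 ^+ k; lra.
Qed.

End Picard.

(** * Local Lipschitz conditions and the radial retraction *)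

Definition locally_lipschitz (R : realType) n (V : normedModType R)
    (f : 'cV[R]_n -> V) : Prop :=
  forall rho, exists2 K, 0 < K & forall u v,
    `|u| <= rho -> `|v| <= rho -> `|f u - f v| <= K * `|u - v|.

Section LocallyLipschitz.
Variables (R : realType) (n : nat).
Implicit Types V W : normedModType R.

Lemma locally_lipschitz_comp V W (g : V -> W) (f : 'cV[R]_n -> V) C : 0 < C ->
  (forall u v, `|g u - g v| <= C * `|u - v|) ->
  locally_lipschitz f -> locally_lipschitz (fun u => g (f u)).
Proof.
move=> C0 gC hf rho; have [K K0 fK] := hf rho.
exists (C * K) => [|u v hu hv]; first exact: mulr_gt0.
by apply: le_trans (gC _ _) _; rewrite -mulrA ler_pM2l //; exact: fK.
Qed.

Lemma locally_lipschitzD V (f g : 'cV[R]_n -> V) :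
  locally_lipschitz f -> locally_lipschitz g ->
  locally_lipschitz (fun u => f u + g u).
Proof.
move=> hf hg rho; have [K K0 fK] := hf rho; have [L L0 gL] := hg rho.
exists (K + L) => [|u v hu hv]; first exact: addr_gt0.
rewrite opprD addrACA mulrDl; apply: le_trans (ler_normD _ _) _.
by apply: lerD; [exact: fK|exact: gL].
Qed.

Lemma locally_lipschitzN V (f : 'cV[R]_n -> V) :
  locally_lipschitz f -> locally_lipschitz (fun u => - f u).
Proof.
apply: (locally_lipschitz_comp (C := 1)) => // u v.
by rewrite -opprD normrN mul1r.
Qed.

Lemma locally_lipschitzZ V (c : R) (f : 'cV[R]_n -> V) :
  locally_lipschitz f -> locally_lipschitz (fun u => c *: f u).
Proof.
apply: (locally_lipschitz_comp (C := `|c| + 1)) => [|u v].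
  by rewrite ltr_wpDl.
by rewrite -scalerBr normrZ ler_wpM2r // lerDl.
Qed.

(** The product rule needs both factors to be bounded on the ball; the
Lipschitz condition itself bounds them, starting from their values at 0. *)
Lemma locally_lipschitzM (f g : 'cV[R]_n -> R) :
  locally_lipschitz f -> locally_lipschitz g ->
  locally_lipschitz (fun u => f u * g u).
Proof.
move=> hf hg rho; have [K K0 fK] := hf rho; have [L L0 gL] := hg rho.
pose r := `|rho|; pose F := `|f 0| + K * r; pose G := `|g 0| + L * r.
have r0 : 0 <= r by exact: normr_ge0.
have F0 : 0 <= F by apply: addr_ge0 => //; apply: mulr_ge0 => //; exact: ltW.
have G0 : 0 <= G by apply: addr_ge0 => //; apply: mulr_ge0 => //; exact: ltW.
exists (F * L + G * K + 1) => [|u v hu hv].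
  by rewrite ltr_wpDl // addr_ge0 // mulr_ge0 // ltW.
have rho0 : 0 <= rho by exact: le_trans hu.
have zr : `|0 : 'cV[R]_n| <= rho by rewrite normr0.
have hF : `|f u| <= F.
  rewrite -[f u](subrK (f 0)) addrC; apply: le_trans (ler_normD _ _) _.
  rewrite lerD2l; apply: le_trans (fK _ _ hu zr) _.
  by rewrite subr0 /r (ger0_norm rho0) ler_pM2l.
have hG : `|g v| <= G.
  rewrite -[g v](subrK (g 0)) addrC; apply: le_trans (ler_normD _ _) _.
  rewrite lerD2l; apply: le_trans (gL _ _ hv zr) _.
  by rewrite subr0 /r (ger0_norm rho0) ler_pM2l.
have -> : f u * g u - f v * g v = f u * (g u - g v) + g v * (f u - f v) by ring.
apply: le_trans (ler_normD _ _) _; rewrite !normrM.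
have h1 : `|f u| * `|g u - g v| <= F * (L * `|u - v|).
  by apply: ler_pM => //; exact: gL.
have h2 : `|g v| * `|f u - f v| <= G * (K * `|u - v|).
  by apply: ler_pM => //; exact: fK.
by have := normr_ge0 (u - v); lra.
Qed.

Lemma locally_lipschitz_coord m (f : 'cV[R]_n -> 'cV[R]_m) i :
  locally_lipschitz f -> locally_lipschitz (fun u => f u i 0).
Proof.
apply: (@locally_lipschitz_comp _ _ (fun v : 'cV[R]_m => v i 0) _ 1) => // u v.
by rewrite mul1r normcv_coordB.
Qed.

Lemma locally_lipschitz_of_coord m (f : 'cV[R]_n -> 'cV[R]_m) :
  (forall i, locally_lipschitz (fun u => f u i 0)) -> locally_lipschitz f.
Proof.
move=> hf rho.
have /choice[K hK] : forall i, exists K, 0 < K /\ forall u v,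
    `|u| <= rho -> `|v| <= rho -> `|f u i 0 - f v i 0| <= K * `|u - v|.
  by move=> i; have [K] := hf i rho; exists K.
have sum_ge0 : 0 <= \sum_i K i by apply: sumr_ge0 => i _; exact/ltW/(hK i).1.
exists (\sum_i K i + 1) => [|u v hu hv]; first by rewrite ltr_wpDl.
apply: normcv_le => [|i]; first by rewrite mulr_ge0 // addr_ge0.
rewrite !mxE; apply: le_trans ((hK i).2 u v hu hv) _.
rewrite ler_wpM2r // (bigD1 i) //= -addrA lerDl addr_ge0 // sumr_ge0 // => j _.
exact/ltW/(hK j).1.
Qed.

End LocallyLipschitz.

Section RadialRetraction.
Variables (R : realType) (n : nat) (rho : R).
Hypothesis rho_gt0 : 0 < rho.

(** Multiplying u by this factor is the radial retraction onto the ball of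
radius rho. Unlike a coordinatewise truncation it moves u along its own
direction, so that a dissipative field stays dissipative when composed with it.
*)
Definition radial_factor (u : 'cV[R]_n) : R := rho / Num.max rho `|u|.

Let max_gt0 (u : 'cV[R]_n) : 0 < Num.max rho `|u|.
Proof. by rewrite lt_max rho_gt0. Qed.

Lemma radial_factor_gt0 u : 0 < radial_factor u.
Proof. exact: divr_gt0. Qed.

Lemma radial_factor1 u : `|u| <= rho -> radial_factor u = 1.
Proof. by move=> h; rewrite /radial_factor max_l // divff // lt0r_neq0. Qed.

Lemma norm_radial u : `|radial_factor u *: u| <= rho.
Proof.
rewrite normrZ gtr0_norm ?radial_factor_gt0 // /radial_factor mulrAC.
by rewrite ler_pdivrMr // ler_pM2l // le_max lexx orbT.
Qed.

(** With a = max(rho, |u|) and b = max(rho, |v|), the difference of the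
retracted points is the sum of (rho / a) (u - v) and (rho (b - a) / (a b)) v,
and each of the two terms has norm at most |u - v|. *)
Lemma radial_lipschitz u v :
  `|radial_factor u *: u - radial_factor v *: v| <= 2 * `|u - v|.
Proof.
set a := Num.max rho `|u|; set b := Num.max rho `|v|.
have a0 : 0 < a := max_gt0 u; have b0 : 0 < b := max_gt0 v.
have abd : `|b - a| <= `|u - v|.
  rewrite distrC ler_norml.
  have := ler_normB v (v - u); have := ler_normB u (u - v).
  rewrite !subKr distrC => h1 h2.
  have := normr_ge0 (u - v); have : `|u| <= a by rewrite le_max lexx orbT.
  have : `|v| <= b by rewrite le_max lexx orbT.
  have : rho <= a by rewrite le_max lexx.
  have : rho <= b by rewrite le_max lexx.
  have : a = rho \/ a = `|u| by rewrite /a; case: leP; [right|left].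
  have : b = rho \/ b = `|v| by rewrite /b; case: leP; [right|left].
  rewrite (distrC v u) in h1 h2 *.
  by case=> ->; case=> -> *; apply/andP; split; lra.
have -> : radial_factor u *: u - radial_factor v *: v =
    (rho / a) *: (u - v) + (rho * (b - a) / (a * b)) *: v.
  have -> : rho * (b - a) / (a * b) = rho / a - rho / b.
    by field; rewrite !lt0r_neq0.
  by rewrite scalerBr scalerBl addrA subrK.
apply: le_trans (ler_normD _ _) _; rewrite mulr_natl mulr2n; apply: lerD.
  rewrite normrZ ler_piMl // gtr0_norm ?divr_gt0 // ler_pdivrMr // mul1r.
  by rewrite le_max lexx.
rewrite normrZ normrM normfV (gtr0_norm (mulr_gt0 a0 b0)).
rewrite normrM (gtr0_norm rho_gt0).
rewrite mulrAC ler_pdivrMr ?mulr_gt0 //.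
have ra : rho <= a by rewrite le_max lexx.
have vb : `|v| <= b by rewrite le_max lexx orbT.
have rv : rho * `|v| <= a * b by apply: ler_pM => //; exact: ltW.
rewrite mulrAC mulrC; apply: ler_pM => //.
by rewrite mulr_ge0 // ltW.
Qed.

End RadialRetraction.

(** * Locally Lipschitz equations that dissipate a quadratic energy *)

Lemma is_derive_sum_sqr (R : realType) n (a : 'I_n -> R) (u : R -> 'cV[R]_n)
    t du :
  coord_derive u t du ->
  is_derive t 1 (fun s => \sum_i a i * u s i 0 ^+ 2)
            (2 * \sum_i a i * (u t i 0 * du i 0)).
Proof.
move=> hu; pose h i : R -> R := a i \*: (fun s => u s i 0) ^+ 2.
have hh i : is_derive t 1 (h i) (2 * (a i * (u t i 0 * du i 0))).
  have hi := hu i; apply: is_derive_eq.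
  by rewrite expr1 /GRing.scale /=; ring.
rewrite (_ : (fun s => _) = \sum_(i < n) h i).
  by rewrite mulr_sumr; exact: is_derive_sum.
by apply/funext => s; rewrite fct_sumE; apply: eq_bigr.
Qed.

Section Dissipative.
Variables (R : realType) (n : nat) (a : 'I_n -> R) (f : 'cV[R]_n -> 'cV[R]_n).
Hypothesis a_gt0 : forall i, 0 < a i.

(** The weighted sum of squares does not increase, and it dominates every
coordinate. The bound depends on the weights and the initial value, not on the
vector field, and so it serves both the equation and its retraction. *)
Lemma dissipative_bound (x0 : 'cV[R]_n) : exists2 rho, 0 < rho &
  forall (x dx : R -> 'cV[R]_n) (t : R), 0 <= t -> x 0 = x0 ->
  (forall s, 0 <= s <= t -> coord_derive x s (dx s)) ->
  (forall s, 0 <= s <= t -> \sum_i a i * (x s i 0 * dx s i 0) <= 0) ->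
  `|x t| <= rho.
Proof.
pose e (u : 'cV[R]_n) := \sum_i a i * u i 0 ^+ 2.
have term_ge0 u i : 0 <= a i * u i 0 ^+ 2 by rewrite mulr_ge0 ?sqr_ge0 // ltW.
have e_ge0 u : 0 <= e u by exact: sumr_ge0.
have q_ge0 i : 0 <= e x0 / a i by rewrite divr_ge0 // ltW.
(* x_i^2 <= r implies |x_i| <= 1 + r, which avoids a square root *)
exists (1 + \sum_i e x0 / a i) => [|x dx t t0 x_0 hx dis].
  by rewrite ltr_pwDl // sumr_ge0.
have le_e : e (x t) <= e x0.
  rewrite -x_0; apply: (nonincreasing_of_derive (u := e \o x)
    (du := fun s => 2 * \sum_i a i * (x s i 0 * dx s i 0)) t0) => s st.
    by apply: is_derive_sum_sqr; exact: hx.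
  by rewrite pmulr_rle0 // dis.
apply: normcv_le => [|i]; first by rewrite addr_ge0 // sumr_ge0.
have xi : x t i 0 ^+ 2 <= e x0 / a i.
  rewrite ler_pdivlMr // mulrC; apply: le_trans le_e.
  by rewrite /e (bigD1 i) //= lerDl sumr_ge0.
have : e x0 / a i <= \sum_i e x0 / a i by rewrite (bigD1 i) //= lerDl sumr_ge0.
set r := \sum_i _ => qr.
have : `|x t i 0| ^+ 2 <= (1 + r) ^+ 2.
  by rewrite real_normK ?num_real //; have := q_ge0 i; nra.
by rewrite ler_pXn2r // nnegrE addr_ge0 // (le_trans (q_ge0 i)).
Qed.

Hypothesis f_lip : locally_lipschitz f.
Hypothesis f_dis : forall u : 'cV[R]_n, \sum_i a i * (u i 0 * f u i 0) <= 0.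

(** Composing f with the radial retraction keeps it dissipative, because the
retraction multiplies x by a positive factor; the a priori bound then shows
that the solution never meets the region where f was modified. *)
Lemma dissipative_ode_exists (x0 : 'cV[R]_n) : exists x : R -> 'cV[R]_n,
  x 0 = x0 /\ forall t, 0 <= t -> coord_derive x t (f (x t)).
Proof.
have [rho rho0 bound] := dissipative_bound x0.
pose s := @radial_factor R n rho; have [K K0 fK] := f_lip rho.
have s0 u : 0 < s u by exact: radial_factor_gt0.
have K2 : 0 < K * 2 by rewrite mulr_gt0.
have g_lip : lipschitz_with (K * 2) (fun u => f (s u *: u)).
  move=> u v; rewrite -mulrA; apply: le_trans (fK _ _ _ _) _.
  - exact: norm_radial.
  - exact: norm_radial.
  - by rewrite ler_pM2l //; exact: radial_lipschitz.
have [x [x_0 dx]] := lipschitz_ode K2 g_lip x0; exists x; split=> // t t0.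
have xb : `|x t| <= rho.
  apply: (bound x (fun r => f (s (x r) *: x r))) => // r /andP[r0 _].
    exact: dx.
  rewrite -(pmulr_rle0 _ (s0 (x r))) mulr_sumr.
  apply: le_trans (f_dis (s (x r) *: x r)); rewrite le_eqVlt; apply/orP; left.
  by apply/eqP; apply: eq_bigr => i _; rewrite !mxE; ring.
by have := dx t t0; rewrite /s radial_factor1 // scale1r.
Qed.

(** Both solutions stay in one ball, where f is Lipschitz; then exp(-ct) times
the squared distance does not increase, and it starts from 0. *)
Lemma dissipative_ode_unique (x y : R -> 'cV[R]_n) (t : R) :
  0 <= t -> x 0 = y 0 ->
  (forall s, 0 <= s <= t -> coord_derive x s (f (x s))) ->
  (forall s, 0 <= s <= t -> coord_derive y s (f (y s))) ->
  x t = y t.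
Proof.
move=> t0 xy0 hx hy; have [rho rho0 bound] := dissipative_bound (y 0).
have [K K0 fK] := f_lip rho.
have sub s : 0 <= s <= t -> forall r, 0 <= r <= s -> 0 <= r <= t.
  by move=> /andP[_ st] r /andP[-> rs]; exact: le_trans st.
have xb s : 0 <= s <= t -> `|x s| <= rho.
  move=> st; apply: (bound x (f \o x)) => // [|r /(sub _ st)]; last exact: hx.
  by case/andP: st.
have yb s : 0 <= s <= t -> `|y s| <= rho.
  move=> st; apply: (bound y (f \o y)) => // [|r /(sub _ st)]; last exact: hy.
  by case/andP: st.
pose D s := \sum_i 1 * (x s - y s) i 0 ^+ 2.
pose dD s := 2 * \sum_i 1 * ((x s - y s) i 0 * (f (x s) - f (y s)) i 0).
have D_derive s : 0 <= s <= t -> is_derive s 1 D (dD s).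
  move=> st; apply: (@is_derive_sum_sqr _ _ (fun=> 1) (fun r => x r - y r)).
  by apply: coord_deriveB; [exact: hx|exact: hy].
have norm_le s : `|x s - y s| ^+ 2 <= D s.
  apply: le_trans (sqr_normcv_le _) _; rewrite le_eqVlt; apply/orP; left.
  by apply/eqP; apply: eq_bigr => i _; rewrite mul1r.
pose c := 2 * n%:R * K.
have dD_le s : 0 <= s <= t -> dD s <= c * D s.
  move=> st; rewrite /c -!mulrA ler_pM2l //.
  rewrite mulr_natl -[X in _ *+ X]card_ord -sumr_const; apply: ler_sum => i _.
  rewrite mul1r; apply: le_trans (ler_norm _) _; rewrite normrM.
  apply: (@le_trans _ _ (`|x s - y s| * (K * `|x s - y s|))).
    apply: ler_pM => //; first exact: normcv_coord.
    apply: le_trans (normcv_coord _ _) _.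
    by apply: fK; [exact: xb|exact: yb].
  by rewrite mulrCA -expr2 ler_pM2l.
have : expR (- c * t) * D t <= expR (- c * 0) * D 0.
  apply: (nonincreasing_of_derive (u := (fun s => expR (- c * s)) * D)
    (du := fun s => expR (- c * s) * dD s + D s * (- c * expR (- c * s))) t0)
    => s st.
    have h1 := D_derive s st; have h2 := is_derive_expRM (- c) s.
    exact: is_deriveM.
  by have := dD_le s st; have := expR_gt0 (- c * s); nra.
have -> : D 0 = 0.
  by apply: big1 => i _; rewrite xy0 subrr mxE expr0n mulr0.
rewrite mulr0 pmulr_rle0 ?expR_gt0 // => Dt.
apply/eqP; rewrite -subr_eq0 -normr_eq0 -[_ == 0]sqrf_eq0 eq_le sqr_ge0 andbT.
exact: le_trans (norm_le t) Dt.
Qed.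

End Dissipative.

(** * Exponential convergence from a Lojasiewicz inequality *)

Section GradientLike.
Variables (R : realType) (H dH S : R -> R) (c0 m : R).
Hypothesis c0_gt0 : 0 < c0.
Hypothesis H_derive : forall t : R, 0 <= t -> is_derive t 1 H (dH t).
Hypothesis S_ge0 : forall t : R, 0 <= t -> 0 <= S t.
Hypothesis H_decay : forall t : R, 0 <= t -> dH t <= - c0 * S t.
Hypothesis H_ge : forall t : R, 0 <= t -> m <= H t.

(** Otherwise H would decrease at least linearly and fall below m. *)
Lemma dissipation_small e T : 0 < e -> exists t, [/\ 0 <= t, T <= t & S t < e].
Proof.
move=> e0; apply: contrapT => noS; pose s := Num.max 0 T.
have s0 : 0 <= s by rewrite le_max lexx.
have Ts : T <= s by rewrite le_max lexx orbT.
have S_ge t : s <= t -> e <= S t.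
  move=> st; rewrite leNgt; apply/negP => St; apply: noS; exists t.
  by split=> //; [exact: le_trans st|exact: le_trans st].
have ce0 : 0 < c0 * e by exact: mulr_gt0.
(* a decrease at rate c0 e brings H from H s to m - 1 at this time *)
pose t := s + (H s - m + 1) / (c0 * e).
have st : s <= t.
  by rewrite lerDl divr_ge0 ?(ltW ce0) //; have := H_ge s0; lra.
have : H t + c0 * e * t <= H s + c0 * e * s.
  apply: (nonincreasing_of_derive (u := H + (c0 * e) \*: id)
            (du := fun x => dH x + (c0 * e) *: 1) st) => x /andP[sx xt];
    have x0 := le_trans s0 sx.
    by have := H_derive x0 => h; apply: is_deriveD.
  have := H_decay x0; have := S_ge x sx; rewrite /GRing.scale /= mulr1 mulNr.
  by rewrite -(ler_pM2l c0_gt0); lra.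
have -> : c0 * e * t = c0 * e * s + (H s - m + 1).
  by rewrite /t mulrDr [c0 * e * (_ / _)]mulrC divfK // lt0r_neq0.
by have := H_ge (le_trans s0 st); lra.
Qed.

(** The level h is arbitrary: one may take for h the limit of H without knowing
that this limit is a critical value. *)
Hypothesis lojasiewicz : forall h, exists d k, [/\ 0 < d, 0 < k &
  forall t : R, 0 <= t -> `|H t - h| <= d -> H t - h <= k * S t].

(** Let h be the infimum of H and W = H - h. With c = c0/(2 k), where k is the
Lojasiewicz constant at the level h, exp(2ct) W does not increase. To control
u, use K sqrt S <= (K/2) (exp(ct) S + exp(-ct)) <= -P' for a suitable P = a
exp(ct) W + b exp(-ct), which is O(exp(-ct)). Thus u - P increases, u + P
decreases, and the limit of u lies in between. The rate and the starting time
depend on neither u nor K. *)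
Lemma exponential_convergence : exists t0 c, [/\ 0 <= t0, 0 < c &
  forall K, 0 < K -> exists2 C, 0 < C & forall u du : R -> R,
    (forall t : R, 0 <= t -> is_derive t 1 u (du t)) ->
    (forall t : R, 0 <= t -> du t ^+ 2 <= K ^+ 2 * S t) ->
    exists l, forall t, t0 <= t -> `|u t - l| <= C * expR (- c * t)].
Proof.
have H_nincr s t : 0 <= s -> s <= t -> H t <= H s.
  move=> s0 st; apply: (nonincreasing_of_derive (du := dH) st) => x /andP[sx _];
    have x0 := le_trans s0 sx; first exact: H_derive.
  apply: le_trans (H_decay x0) _.
  by rewrite mulNr oppr_le0; apply: mulr_ge0; [exact: ltW|exact: S_ge0].
pose A := [set H t | t in [set t | 0 <= t]].
have infA : has_inf A.
  split; last by exists m => _ [t t0 <-]; exact: H_ge.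
  by exists (H 0); exists 0 => //=; rewrite lexx.
pose h := inf A.
have H_geh t : 0 <= t -> h <= H t.
  by move=> t0; apply: ge_inf; [exact: infA.2|exists t].
have [d [k [d0 k0 loja]]] := lojasiewicz h.
have [_ [t0 t0_ge0 <-] Ht0] := inf_adherent d0 infA.
have W_le t : t0 <= t -> H t - h <= k * S t.
  move=> tt; have t_ge0 := le_trans t0_ge0 tt; apply: loja => //.
  rewrite ger0_norm ?subr_ge0 ?H_geh //.
  by have := H_nincr _ _ t0_ge0 tt; rewrite -/h in Ht0; lra.
have [c c_gt0 ck] : exists2 c, 0 < c & c * k = c0 / 2.
  exists (c0 / (2 * k)); first by rewrite divr_gt0 // mulr_gt0.
  by field; rewrite lt0r_neq0.
pose W t := H t - h.
have W_ge0 t : t0 <= t -> 0 <= W t.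
  by move=> tt; rewrite subr_ge0 H_geh // (le_trans t0_ge0 tt).
have W_derive t : t0 <= t -> is_derive t 1 W (dH t).
  move=> tt; have := H_derive (le_trans t0_ge0 tt) => hH.
  rewrite (_ : W = H - cst h) //; apply: is_derive_eq; exact: subr0.
have cW t : t0 <= t -> c * W t <= c0 / 2 * S t.
  by move=> tt; rewrite -ck -mulrA ler_pM2l //; exact: W_le.
have W_exp t : t0 <= t ->
    expR (2 * c * t) * W t <= expR (2 * c * t0) * W t0.
  move=> tt.
  apply: (nonincreasing_of_derive (u := (fun s => expR (2 * c * s)) * W)
    (du := fun s => expR (2 * c * s) * dH s + W s * (2 * c * expR (2 * c * s)))
    tt) => s /andP[ts _].
    have h1 := W_derive s ts; have h2 := is_derive_expRM (2 * c) s.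
    exact: is_deriveM.
  have := H_decay (le_trans t0_ge0 ts); have := cW s ts.
  by have := expR_gt0 (2 * c * s); nra.
exists t0, c; split=> // K K0.
pose w0 := expR (2 * c * t0) * W t0.
have w0_ge0 : 0 <= w0 by rewrite mulr_ge0 ?expR_ge0 // W_ge0.
(* a and b are such that - P' >= (K / 2) (exp(ct) S + exp(-ct)) *)
have [a a_gt0 ac] : exists2 a, 0 < a & a * c0 = K.
  by exists (K / c0); [exact: divr_gt0|rewrite divfK // lt0r_neq0].
have [b b_gt0 bc] : exists2 b, 0 < b & b * c = K / 2.
  exists (K / (2 * c)); first by rewrite divr_gt0 // mulr_gt0.
  by field; rewrite lt0r_neq0.
exists (a * w0 + b) => [|u du u_derive du_le].
  by rewrite ltr_wpDl // mulr_ge0 // ltW.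
pose P t := a * (expR (c * t) * W t) + b * expR (- c * t).
pose dP t := a * (expR (c * t) * dH t + W t * (c * expR (c * t)))
             + b * (- c * expR (- c * t)).
have P_derive t : t0 <= t -> is_derive t 1 P (dP t).
  move=> tt; have h1 := W_derive t tt; have h2 := is_derive_expRM c t.
  have h3 := is_derive_expRM (- c) t.
  rewrite (_ : P = a \*: ((fun s => expR (c * s)) * W)
                   + b \*: (fun s => expR (- c * s))) //.
  exact: is_derive_eq.
have P_ge0 t : t0 <= t -> 0 <= P t.
  move=> tt; have := W_ge0 t tt; have := expR_gt0 (c * t).
  have := expR_gt0 (- c * t) => e1 e2 Wt.
  by rewrite addr_ge0 // mulr_ge0 ?(ltW a_gt0) ?(ltW b_gt0) ?mulr_ge0 // ltW.
have P_le t : t0 <= t -> P t <= (a * w0 + b) * expR (- c * t).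
  move=> tt; rewrite mulrDl lerD2r -mulrA ler_pM2l //.
  have -> : expR (c * t) * W t = expR (2 * c * t) * W t * expR (- c * t).
    by rewrite [RHS]mulrAC -expRD; congr (expR _ * _); ring.
  by rewrite ler_pM2r ?expR_gt0 //; exact: W_exp.
have du_dP t : t0 <= t -> `|du t| <= - dP t.
  move=> tt; have t_ge0 := le_trans t0_ge0 tt.
  pose E := expR (c * t); pose F := expR (- c * t).
  have EF : E * F = 1 by rewrite /E /F -expRD mulNr subrr expR0.
  have E0 : 0 < E by exact: expR_gt0.
  have F0 : 0 < F by exact: expR_gt0.
  apply: (@le_trans _ _ (K / 2 * (E * S t + F))).
    have X0 : 0 <= K / 2 * (E * S t + F).
      by rewrite mulr_ge0 ?divr_ge0 ?addr_ge0 ?mulr_ge0 ?S_ge0 // ltW.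
    rewrite -(@ler_pXn2r _ 2) ?nnegrE // real_normK ?num_real //.
    apply: le_trans (du_le t t_ge0) _.
    have -> : (K / 2 * (E * S t + F)) ^+ 2 =
              K ^+ 2 * (((E * S t - F) / 2) ^+ 2 + (E * F) * S t) by field.
    by rewrite EF mul1r ler_pM2l ?exprn_gt0 // lerDr sqr_ge0.
  have := H_decay t_ge0; have := cW t tt; rewrite /dP -/E -/F => h1 h2.
  have h3 : a * (E * (c * W t + dH t)) <= a * (E * (- (c0 / 2) * S t)).
    by rewrite ler_pM2l // ler_pM2l //; lra.
  have -> : K / 2 * (E * S t + F) = a * c0 / 2 * E * S t + b * c * F.
    by rewrite ac bc; ring.
  lra.
have incr s t : t0 <= s -> s <= t -> `|u t - u s| <= P s - P t.
  move=> ts st.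
  suff : `|u t - u s| <= - P t - - P s by rewrite opprK (addrC (- P t)).
  apply: (increment_le_of_derive_le (du := du) (w := - P)
            (dw := fun x => - dP x) st) => x /andP[sx _].
  - by apply: u_derive; apply: le_trans sx; exact: le_trans ts.
  - by have := P_derive x (le_trans ts sx) => hP; exact: is_deriveN.
  - exact/du_dP/(le_trans ts sx).
(* the bounds hold from t0 on only, hence the maxima *)
have cross s t : u (Num.max t0 s) - P (Num.max t0 s) <=
                 u (Num.max t0 t) + P (Num.max t0 t).
  have ms r : t0 <= Num.max t0 r by rewrite le_max lexx.
  move: (ms s) (ms t); move: (Num.max t0 s) (Num.max t0 t) => {}s {}t hs ht.
  have := P_ge0 s hs; have := P_ge0 t ht.
  have [st|/ltW ts] := leP s t.
    by have := incr s t hs st; rewrite ler_norml => /andP[]; lra.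
  by have := incr t s ht ts; rewrite ler_norml => /andP[]; lra.
have [l hl] := separation_point t0 cross; exists l => t tt.
have := hl t; rewrite max_r // => /andP[h1 h2].
by apply: le_trans (P_le t tt); rewrite ler_norml; apply/andP; split; lra.
Qed.

End GradientLike.

(** * Vectors in dimension three *)

Section Vectors3.
Variable R : realType.
Implicit Types (u v w : 'cV[R]_3) (A : 'M[R]_3).

Lemma sum3E (V : nmodType) (F : 'I_3 -> V) : \sum_i F i = F 0 + F 1 + F 2.
Proof.
rewrite !big_ord_recl big_ord0 addr0 addrA.
by congr (_ + F _ + F _); exact: val_inj.
Qed.

(** Reaches the index of a coordinate as one of the literals 0, 1, 2, which is
how the cross product and the scalar product are written. *)
Lemma ord3_ind (P : 'I_3 -> Prop) : P 0 -> P 1 -> P 2 -> forall i, P i.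
Proof.
move=> P0 P1 P2; case=> [[|[|[|//]]]] hi.
- by rewrite (_ : Ordinal hi = 0) //; exact: val_inj.
- by rewrite (_ : Ordinal hi = 1) //; exact: val_inj.
- by rewrite (_ : Ordinal hi = 2) //; exact: val_inj.
Qed.

Definition dot u v : R := \sum_i u i 0 * v i 0.

Lemma dotE u v : dot u v = u 0 0 * v 0 0 + u 1 0 * v 1 0 + u 2 0 * v 2 0.
Proof. exact: sum3E. Qed.

Lemma dotBl u v w : dot (u - v) w = dot u w - dot v w.
Proof. by rewrite !dotE !mxE; ring. Qed.

Lemma crossmulE u v :
  (crossmul u v 0 0 = u 1 0 * v 2 0 - u 2 0 * v 1 0) *
  (crossmul u v 1 0 = u 2 0 * v 0 0 - u 0 0 * v 2 0) *
  (crossmul u v 2 0 = u 0 0 * v 1 0 - u 1 0 * v 0 0).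
Proof. by rewrite !mxE. Qed.

Lemma norm_dot u v : `|dot u v| <= 3 * (`|u| * `|v|).
Proof.
apply: le_trans (ler_norm_sum _ _ _) _; rewrite sum3E !normrM.
have h i : `|u i 0| * `|v i 0| <= `|u| * `|v|.
  by apply: ler_pM => //; exact: normcv_coord.
by have := h 0; have := h 1; have := h 2; lra.
Qed.

Lemma sqr_norm_le_dot u : `|u| ^+ 2 <= dot u u.
Proof. exact: sqr_normcv_le. Qed.

Lemma norm_crossmul u v : `|crossmul u v| <= 2 * (`|u| * `|v|).
Proof.
have h i j : `|u i 0 * v j 0| <= `|u| * `|v|.
  by rewrite normrM; apply: ler_pM => //; exact: normcv_coord.
apply: normcv_le => [|]; first by rewrite !mulr_ge0.
rewrite mulr_natl mulr2n.
by apply: ord3_ind; rewrite crossmulE; apply: le_trans (ler_normB _ _) _;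
  exact: lerD.
Qed.

(** The constants of the estimates below are never made explicit, so a crude
operator bound is enough. *)
Lemma norm_mulmx A : exists2 C, 0 < C & forall v, `|A *m v| <= C * `|v|.
Proof.
pose C := \sum_i \sum_j `|A i j|.
have C0 : 0 <= C by apply: sumr_ge0 => i _; exact: sumr_ge0.
exists (C + 1) => [|v]; first by rewrite ltr_wpDl.
apply: normcv_le => [|i]; first by rewrite mulr_ge0 // addr_ge0.
rewrite mxE; apply: le_trans (ler_norm_sum _ _ _) _.
apply: (@le_trans _ _ (\sum_j `|A i j| * `|v|)).
  by apply: ler_sum => j _; rewrite normrM ler_wpM2l // normcv_coord.
rewrite -mulr_suml ler_wpM2r // ler_wpDr // /C [leRHS](bigD1 i) //= lerDl.
by apply: sumr_ge0 => j _; exact: sumr_ge0.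
Qed.

Lemma enorm_le (u : 'cV[R]_3) c : (forall i, `|u i 0| <= c) -> enorm u <= 3 * c.
Proof.
move=> uc; have c0 : 0 <= c by apply: le_trans (uc 0).
rewrite /enorm -(@ler_pXn2r _ 2) ?nnegrE ?sqrtr_ge0 ?mulr_ge0 //.
rewrite sqr_sqrtr; last by apply: sumr_ge0 => i _; exact: sqr_ge0.
have h i : u i 0 ^+ 2 <= c ^+ 2.
  by rewrite -(@real_normK _ (u i 0)) ?num_real // ler_pXn2r ?nnegrE.
by rewrite sum3E; have := h 0; have := h 1; have := h 2; have := sqr_ge0 c; lra.
Qed.

Lemma locally_lipschitz_crossmul n (f g : 'cV[R]_n -> 'cV[R]_3) :
  locally_lipschitz f -> locally_lipschitz g ->
  locally_lipschitz (fun x => crossmul (f x) (g x)).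
Proof.
move=> hf hg; apply: locally_lipschitz_of_coord.
have minor i j : locally_lipschitz
    (fun x => f x i 0 * g x j 0 - f x j 0 * g x i 0).
  apply: locally_lipschitzD; last apply: locally_lipschitzN;
    by apply: locally_lipschitzM; exact: locally_lipschitz_coord.
apply: ord3_ind.
- by under eq_fun do rewrite crossmulE; exact: minor.
- by under eq_fun do rewrite crossmulE; exact: minor.
- by under eq_fun do rewrite crossmulE; exact: minor.
Qed.

Lemma is_derive_dot (u v : R -> 'cV[R]_3) t du dv :
  coord_derive u t du -> coord_derive v t dv ->
  is_derive t 1 (fun s => dot (u s) (v s)) (dot du (v t) + dot (u t) dv).
Proof.
move=> hu hv; pose c (f : R -> 'cV[R]_3) i s := f s i 0.
have hc i : is_derive t 1 (c u i * c v i) (c u i t * dv i 0 + c v i t * du i 0).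
  by have h1 := hu i; have h2 := hv i; exact: is_deriveM.
rewrite (_ : (fun s => _) = \sum_(i < 3) (c u i * c v i)).
  have -> : dot du (v t) + dot (u t) dv =
            \sum_(i < 3) (c u i t * dv i 0 + c v i t * du i 0).
    rewrite /dot -big_split; apply: eq_bigr => i _ /=.
    by rewrite addrC [du i 0 * _]mulrC.
  exact: is_derive_sum.
by apply/funext => s; rewrite fct_sumE.
Qed.

Lemma coord_derive_mulmx A (u : R -> 'cV[R]_3) t du :
  coord_derive u t du -> coord_derive (fun s => A *m u s) t (A *m du).
Proof.
move=> hu i; pose a : 'cV[R]_3 := \col_j A i j.
have rowE v : (A *m v) i 0 = dot a v.
  by rewrite mxE; apply: eq_bigr => j _; rewrite mxE.
rewrite (_ : (fun s => _) = (fun s => dot a (u s))).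
  have ha : coord_derive (fun=> a) t 0.
    by move=> j; apply: is_derive_eq; rewrite mxE.
  have := is_derive_dot ha hu; rewrite rowE (_ : dot 0 _ = 0) ?add0r //.
  by rewrite /dot big1 // => j _; rewrite mxE mul0r.
by apply/funext => s; exact: rowE.
Qed.

Lemma coord_derive_crossmul (u v : R -> 'cV[R]_3) t du dv :
  coord_derive u t du -> coord_derive v t dv ->
  coord_derive (fun s => crossmul (u s) (v s)) t
    (crossmul du (v t) + crossmul (u t) dv).
Proof.
move=> hu hv; pose c (f : R -> 'cV[R]_3) i s := f s i 0.
have minor i j : is_derive t 1 (c u i * c v j - c u j * c v i)
    (du i 0 * v t j 0 - du j 0 * v t i 0
     + (u t i 0 * dv j 0 - u t j 0 * dv i 0)).
  have h1 := hu i; have h2 := hv j; have h3 := hu j; have h4 := hv i.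
  have h5 : is_derive t 1 (c u i * c v j) (c u i t * dv j 0 + c v j t * du i 0).
    exact: is_deriveM.
  have h6 : is_derive t 1 (c u j * c v i) (c u j t * dv i 0 + c v i t * du j 0).
    exact: is_deriveM.
  by apply: is_derive_eq; rewrite /c; ring.
by apply: ord3_ind; rewrite mxE !crossmulE;
  under eq_fun do rewrite crossmulE; exact: minor.
Qed.

End Vectors3.

(** * Algebra of the rigid body with a damper *)

Section Diagonal.
Variables (R : realType) (a b c : R).

Lemma inertia_mulE (u : 'cV[R]_3) :
  ((inertia a b c *m u) 0 0 = a * u 0 0) *
  ((inertia a b c *m u) 1 0 = b * u 1 0) *
  ((inertia a b c *m u) 2 0 = c * u 2 0).
Proof. by rewrite /inertia !mul_diag_mx !mxE. Qed.

Lemma invmx_inertia : a != 0 -> b != 0 -> c != 0 ->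
  invmx (inertia a b c) = inertia a^-1 b^-1 c^-1.
Proof.
move=> a0 b0 c0; have JK : inertia a b c *m inertia a^-1 b^-1 c^-1 = 1%:M.
  rewrite /inertia mulmx_diag; apply/matrixP => i j; rewrite !mxE.
  case: (i == j); rewrite ?mulr0n ?mulr1n //.
  by elim/ord3_ind: i; rewrite /= divff.
have [uJ _] := mulmx1_unit JK.
by rewrite -[LHS]mulmx1 -JK mulKmx.
Qed.

End Diagonal.

Lemma cV3P (R : realType) (u v : 'cV[R]_3) :
  u 0 0 = v 0 0 -> u 1 0 = v 1 0 -> u 2 0 = v 2 0 -> u = v.
Proof. by move=> e0 e1 e2; apply/colP; exact: ord3_ind. Qed.

Section System.
Variables (R : realType) (k I A1 A2 A3 : R).
Hypotheses (k_gt0 : 0 < k) (I_gt0 : 0 < I) (A1_gt0 : 0 < A1).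
Hypotheses (A12 : A1 <= A2) (A23 : A2 <= A3).
Implicit Types w p : 'cV[R]_3.

Let A2_gt0 : 0 < A2. Proof. exact: lt_le_trans A12. Qed.
Let A3_gt0 : 0 < A3. Proof. exact: lt_le_trans A23. Qed.

Local Notation J := (inertia A1 A2 A3).
Local Notation Jinv := (invmx (inertia A1 A2 A3)).
Local Notation V := (vfield k I J).

(** Total angular momentum, in the frame of the body. *)
Definition momentum w p : 'cV[R]_3 := J *m w + I *: p.

Lemma momentumE w p :
  (momentum w p 0 0 = A1 * w 0 0 + I * p 0 0) *
  (momentum w p 1 0 = A2 * w 1 0 + I * p 1 0) *
  (momentum w p 2 0 = A3 * w 2 0 + I * p 2 0).
Proof.
have E i : momentum w p i 0 = (J *m w) i 0 + I * p i 0.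
  by rewrite mxE [X in _ + X]mxE.
by rewrite !E !inertia_mulE.
Qed.

(** Minus the rate of change of the angular momentum, see momentum_rate. It
vanishes together with the slip p - w exactly at the equilibria. *)
Definition gyro w p : 'cV[R]_3 := crossmul w (momentum w p).

Lemma JinvE (u : 'cV[R]_3) :
  ((Jinv *m u) 0 0 = A1^-1 * u 0 0) *
  ((Jinv *m u) 1 0 = A2^-1 * u 1 0) *
  ((Jinv *m u) 2 0 = A3^-1 * u 2 0).
Proof. by rewrite invmx_inertia ?lt0r_neq0 // !inertia_mulE. Qed.

Lemma mulJJinv (u : 'cV[R]_3) : J *m (Jinv *m u) = u.
Proof.
by apply: cV3P; rewrite inertia_mulE JinvE mulVKf // lt0r_neq0.
Qed.

Lemma crossmul_momentum w p :
  crossmul w (J *m w) = gyro w p - I *: crossmul w (p - w).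
Proof.
rewrite /gyro /momentum; move: (J *m w) => j.
by apply/colP => i; rewrite !mxE; elim/ord3_ind: i => /=; ring.
Qed.

Lemma crossmul_slip w p : crossmul w p = crossmul w (p - w).
Proof. by apply/colP => i; rewrite !mxE; elim/ord3_ind: i => /=; ring. Qed.

(** Both components of the field are expressed through the slip and gyro only,
which makes visible that they are small when these two are. *)
Lemma vfield1E w p : (V (w, p)).1 =
  Jinv *m (k *: (p - w) - gyro w p + I *: crossmul w (p - w)).
Proof. by rewrite /= (crossmul_momentum w p) opprB addrA addrAC. Qed.

Lemma vfield2E w p :
  (V (w, p)).2 = - (k / I) *: (p - w) - crossmul w (p - w).
Proof. by rewrite /= crossmul_slip. Qed.

Lemma momentum_rate w p : momentum (V (w, p)).1 (V (w, p)).2 = - gyro w p.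
Proof.
rewrite /momentum vfield1E vfield2E mulJJinv.
move: (gyro w p) (crossmul w (p - w)) => q c; apply/colP => i; rewrite !mxE.
by field; rewrite lt0r_neq0.
Qed.

(** The gyroscopic terms do no work; only the friction contributes. *)
Lemma energy_rate w p :
  dot w (J *m (V (w, p)).1) + I * dot p (V (w, p)).2 =
  - k * dot (p - w) (p - w).
Proof.
rewrite [(V _).1]/= mulJJinv [(V _).2]/=; move: (J *m w) => j.
by rewrite !dotE !mxE /=; field; rewrite lt0r_neq0.
Qed.

(** The inverse of J + I, which recovers from the momentum the common angular
velocity of body and damper when the slip vanishes. *)
Definition total_inertia_inv : 'M[R]_3 :=
  inertia (A1 + I)^-1 (A2 + I)^-1 (A3 + I)^-1.

Local Notation B := total_inertia_inv.

Let neqs : (A1 + I != 0) * (A2 + I != 0) * (A3 + I != 0).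
Proof. by rewrite !lt0r_neq0 // addr_gt0. Qed.

Lemma mul_total_inertia_inv w p :
  B *m momentum w p = w + I *: (B *m (p - w)).
Proof.
by apply: cV3P; rewrite [RHS]mxE [X in _ + X]mxE !inertia_mulE !momentumE !mxE;
  field; rewrite neqs.
Qed.

(** Up to a scalar factor and a quarter turn, the left-hand side is the
tangential gradient on the sphere of the form M . B M; it is the quantity that
the Lojasiewicz inequality controls. *)
Lemma crossmul_total_inertia_inv w p :
  crossmul (momentum w p) (B *m momentum w p) =
  - gyro w p + I *: crossmul (momentum w p) (B *m (p - w)).
Proof.
rewrite mul_total_inertia_inv /gyro; move: (momentum w p) (B *m _) => m b.
by apply/colP => i; rewrite !mxE; elim/ord3_ind: i => /=; ring.
Qed.

(** Twice the kinetic energy. *)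
Definition energy w p : R := dot w (J *m w) + I * dot p p.

(** The energy is a function of the momentum alone plus a quadratic form in the
slip. The former is what varies along the sphere of constant |M|, so only for
it is a Lojasiewicz inequality needed. *)
Lemma energy_split w p :
  energy w p = dot (momentum w p) (B *m momentum w p)
             + I * dot (p - w) (J *m (B *m (p - w))).
Proof.
rewrite /energy !dotE !inertia_mulE !momentumE !mxE.
by field; rewrite !neqs.
Qed.

(** The system on a single six-dimensional space, to which the general results
on differential equations apply. *)
Definition state_field (x : 'cV[R]_(3 + 3)) : 'cV[R]_(3 + 3) :=
  col_mx (V (usubmx x, dsubmx x)).1 (V (usubmx x, dsubmx x)).2.

(** Coefficients of twice the kinetic energy as a sum of squares of
coordinates. *)
Definition energy_weight (i : 'I_(3 + 3)) : R :=
  col_mx (\col_j [:: A1; A2; A3]`_j) (const_mx I : 'cV_3) i 0.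

Lemma energy_weight_gt0 i : 0 < energy_weight i.
Proof.
rewrite /energy_weight; case: (split_ordP i) => j ->.
  by rewrite col_mxEu mxE; elim/ord3_ind: j.
by rewrite col_mxEd mxE.
Qed.

Lemma energy_weight_sum (x y : 'cV[R]_(3 + 3)) :
  \sum_i energy_weight i * (x i 0 * y i 0) =
  dot (usubmx x) (J *m usubmx y) + I * dot (dsubmx x) (dsubmx y).
Proof.
rewrite big_split_ord /=; congr (_ + _).
  rewrite dotE !inertia_mulE sum3E /energy_weight !col_mxEu !mxE /=.
  by congr (_ + _ + _); exact: mulrCA.
rewrite /dot mulr_sumr; apply: eq_bigr => i _.
by rewrite /energy_weight col_mxEd !mxE.
Qed.

Lemma state_field_dissipative (x : 'cV[R]_(3 + 3)) :
  \sum_i energy_weight i * (x i 0 * state_field x i 0) <= 0.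
Proof.
rewrite energy_weight_sum /state_field col_mxKu col_mxKd energy_rate mulNr.
rewrite oppr_le0.
rewrite mulr_ge0 ?(ltW k_gt0) //.
by apply: le_trans (sqr_norm_le_dot _); exact: sqr_ge0.
Qed.

Lemma state_field_locally_lipschitz : locally_lipschitz state_field.
Proof.
have lin (A : 'M[R]_3) (f : 'cV[R]_(3 + 3) -> 'cV[R]_3) :
    locally_lipschitz f -> locally_lipschitz (fun x => A *m f x).
  have [C C0 hC] := norm_mulmx A.
  by apply: (locally_lipschitz_comp C0) => u v; rewrite -mulmxBr.
have Lw : locally_lipschitz (fun x : 'cV[R]_(3 + 3) => usubmx x).
  move=> rho; exists 1 => // u v _ _; rewrite mul1r; apply: normcv_le => // i.
  by rewrite !mxE normcv_coordB.
have Lp : locally_lipschitz (fun x : 'cV[R]_(3 + 3) => dsubmx x).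
  move=> rho; exists 1 => // u v _ _; rewrite mul1r; apply: normcv_le => // i.
  by rewrite !mxE normcv_coordB.
have Lz : locally_lipschitz (fun x : 'cV[R]_(3 + 3) => dsubmx x - usubmx x).
  by apply: locally_lipschitzD => //; exact: locally_lipschitzN.
have L1 : locally_lipschitz (fun x => (V (usubmx x, dsubmx x)).1).
  apply: (lin); apply: locally_lipschitzD; first exact: locally_lipschitzZ.
  apply: locally_lipschitzN.
  by apply: locally_lipschitz_crossmul => //; exact: lin.
have L2 : locally_lipschitz (fun x => (V (usubmx x, dsubmx x)).2).
  apply: locally_lipschitzD; first exact: locally_lipschitzZ.
  by apply: locally_lipschitzN; exact: locally_lipschitz_crossmul.
apply: locally_lipschitz_of_coord => i; case: (split_ordP i) => j ->.
  by under eq_fun do rewrite col_mxEu; exact: locally_lipschitz_coord.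
by under eq_fun do rewrite col_mxEd; exact: locally_lipschitz_coord.
Qed.

End System.

(** * Lojasiewicz inequality for a quadratic form on a sphere *)

Lemma positive_gap (R : realType) n (f : 'I_n -> R) : exists2 d, 0 < d &
  forall i, f i != 0 -> d <= `|f i|.
Proof.
exists (\big[Num.min/1]_(i | f i != 0) `|f i|) => [|i fi].
  by apply: lt_bigmin => // i; rewrite normr_gt0.
exact: bigmin_le_cond.
Qed.

(** Up to powers of mu = |m|^2, the values F = m . B m and |m x B m|^2 are the
mean and the variance of the b_i for the probability weights m_i^2 / mu: mu |m
x B m|^2 is the sum of (mu b_i - F)^2 m_i^2. Since mu (F - h) is the sum of (mu
b_i - h) m_i^2, only the indices with mu b_i <> h contribute to it, and for
those |mu b_i - F| stays away from 0 when F is close to h. So the inequality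
holds term by term; it depends on the value F only, not on the position of m.
*)
Lemma quadratic_form_lojasiewicz (R : realType) (b1 b2 b3 mu h : R) :
  let B := inertia b1 b2 b3 in
  exists d C, [/\ 0 < d, 0 < C & forall m : 'cV[R]_3, dot m m = mu ->
    `|dot m (B *m m) - h| <= d ->
    `|dot m (B *m m) - h| <=
      C * dot (crossmul m (B *m m)) (crossmul m (B *m m))].
Proof.
move=> B; pose b (i : 'I_3) := [:: b1; b2; b3]`_i.
have FE m : dot m (B *m m) = \sum_i b i * m i 0 ^+ 2.
  by rewrite dotE sum3E !inertia_mulE /b /=; ring.
(* on the degenerate sphere m = 0 the form only takes the value 0 *)
have [mu0|mu_gt0] := leP mu 0.
  have m0 (m : 'cV[R]_3) : dot m m = mu -> m = 0.
    move=> mE; apply/eqP; rewrite -normr_eq0 -sqrf_eq0 eq_le sqr_ge0 andbT.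
    by apply: le_trans (sqr_norm_le_dot m) _; rewrite mE.
  have F0 m : dot m m = mu -> dot m (B *m m) = 0.
    by move/m0 => ->; rewrite FE big1 // => i _; rewrite mxE expr0n mulr0.
  have [->|h0] := eqVneq h 0.
    exists 1, 1; split=> // m /F0 -> _; rewrite subr0 normr0 mul1r.
    by apply: le_trans (sqr_norm_le_dot _); exact: sqr_ge0.
  exists (`|h| / 2), 1; split=> //; first by rewrite divr_gt0 // normr_gt0.
  move=> m /F0 ->; rewrite sub0r normrN.
  have : 0 < `|h| by rewrite normr_gt0.
  lra.
have [d d0 gap] := positive_gap (fun i : 'I_3 => mu * b i - h).
pose D := \sum_i `|mu * b i - h|; pose K := D / (d / 2) ^+ 2.
have D0 : 0 <= D by exact: sumr_ge0.
have d2 : 0 < (d / 2) ^+ 2 by rewrite exprn_gt0 // divr_gt0.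
have K0 : 0 <= K by rewrite divr_ge0 // ltW.
exists (d / 2), (K + 1); split; [by rewrite divr_gt0|by rewrite ltr_wpDl|].
move=> m mE; set F := dot m _ => Fh; set g := crossmul m _.
have gg : mu * dot g g = \sum_i (mu * b i - F) ^+ 2 * m i 0 ^+ 2.
  rewrite /g /F -mE !sum3E !dotE !crossmulE !inertia_mulE /b /=; ring.
have g0 : 0 <= dot g g by apply: le_trans (sqr_norm_le_dot _); exact: sqr_ge0.
apply: (@le_trans _ _ (K * dot g g)); last by rewrite mulrDl mul1r lerDl.
rewrite -(ler_pM2l mu_gt0) mulrCA gg mulr_sumr -{1}(gtr0_norm mu_gt0) -normrM.
have -> : mu * (F - h) = \sum_i (mu * b i - h) * m i 0 ^+ 2.
  have -> : mu * (F - h) = mu * F - h * dot m m by rewrite mE; ring.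
  by rewrite /F FE dotE !sum3E; ring.
apply: le_trans (ler_norm_sum _ _ _) _; apply: ler_sum => i _.
rewrite normrM (ger0_norm (sqr_ge0 (m i 0))) [leRHS]mulrA ler_wpM2r ?sqr_ge0 //.
have [->|/gap ge_d] := eqVneq (mu * b i - h) 0.
  by rewrite normr0 mulr_ge0 // sqr_ge0.
have le_D : `|mu * b i - h| <= D by rewrite /D (bigD1 i) //= lerDl sumr_ge0.
apply: le_trans le_D _; rewrite /K mulrAC ler_pdivlMr //.
apply: ler_wpM2l => //.
rewrite -[leRHS]real_normK ?num_real //.
rewrite ler_pXn2r ?nnegrE ?divr_ge0 ?(ltW d0) //.
have := ler_distD F (mu * b i) h; lra.
Qed.

(** * Convergence of bounded trajectories *)

(** A Lyapunov function that only dissipates x^2 is corrected by a small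
multiple e of a term that dissipates y^2: the cross term is absorbed half by
y^2, and half by x^2 at the price of a constant, which e compensates. *)
Lemma cross_term_absorbed (R : realType) (k a C : R) :
  0 < k -> 0 < a -> 0 < C -> exists e c, [/\ 0 < e, 0 < c & forall x y : R,
    - k * x ^+ 2 - e * (a * y ^+ 2 - C * (x * y) - C * x ^+ 2) <=
    - c * (x ^+ 2 + y ^+ 2)].
Proof.
move=> k0 a0 C0; pose L := C + C ^+ 2 / (2 * a).
have L0 : 0 < L by rewrite addr_gt0 // divr_gt0 ?exprn_gt0 // mulr_gt0.
have [e e0 eL] : exists2 e, 0 < e & e * L = k / 2.
  exists (k / 2 / L); first by rewrite !divr_gt0.
  by rewrite divfK // lt0r_neq0.
pose c := Num.min (k / 2) (e * a / 2).
exists e, c; split=> // [|x y].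
  by rewrite lt_min !divr_gt0 // mulr_gt0.
have c1 : c <= k / 2 by rewrite ge_min lexx.
have c2 : c <= e * a / 2 by rewrite ge_min lexx orbT.
have xy : C * (x * y) <= a / 2 * y ^+ 2 + C ^+ 2 / (2 * a) * x ^+ 2.
  have -> : a / 2 * y ^+ 2 + C ^+ 2 / (2 * a) * x ^+ 2 =
            C * (x * y) + (a * y - C * x) ^+ 2 / (2 * a).
    by field; rewrite lt0r_neq0.
  by rewrite lerDl divr_ge0 ?sqr_ge0 // mulr_ge0 // ltW.
have h1 : e * (C * (x * y) + C * x ^+ 2) <= e * (a / 2 * y ^+ 2 + L * x ^+ 2).
  by rewrite ler_pM2l // /L; lra.
have h2 : e * (L * x ^+ 2) = k / 2 * x ^+ 2 by rewrite mulrA eL.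
have h3 : c * x ^+ 2 <= k / 2 * x ^+ 2 by rewrite ler_wpM2r // sqr_ge0.
have h4 : c * y ^+ 2 <= e * a / 2 * y ^+ 2 by rewrite ler_wpM2r // sqr_ge0.
lra.
Qed.

Section Trajectory.
Variables (R : realType) (k I A1 A2 A3 : R).
Hypotheses (k_gt0 : 0 < k) (I_gt0 : 0 < I) (A1_gt0 : 0 < A1).
Hypotheses (A12 : A1 <= A2) (A23 : A2 <= A3).

Local Notation J := (inertia A1 A2 A3).
Local Notation Jinv := (invmx (inertia A1 A2 A3)).
Local Notation V := (vfield k I J).
Local Notation B := (total_inertia_inv I A1 A2 A3).
Local Notation mom := (momentum I A1 A2 A3).
Local Notation gyr := (gyro I A1 A2 A3).

Let A2_gt0 : 0 < A2. Proof. exact: lt_le_trans A12. Qed.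
Let A3_gt0 : 0 < A3. Proof. exact: lt_le_trans A23. Qed.

(** Derivative of gyro along the system, from momentum_rate. *)
Definition gyro_rate (w p : 'cV[R]_3) : 'cV[R]_3 :=
  crossmul (V (w, p)).1 (mom w p) + crossmul w (- gyr w p).

(** Everything is quadratic, so on a ball each rate is at most a constant times
|p - w| + |gyro w p|. The estimate by |p - w| alone is sharper and is the
decisive one: up to a multiple of the slip, the slip changes at the rate Jinv
gyro, whose scalar product with gyro is positive. *)
Lemma rate_bounds rho : exists2 C, 0 < C & forall w p : 'cV[R]_3,
  `|w| <= rho -> `|p| <= rho ->
  [/\ `|p - w| <= C /\ `|gyr w p| <= C,
      `|(V (w, p)).1| <= C * (`|p - w| + `|gyr w p|) /\
      `|(V (w, p)).2| <= C * (`|p - w| + `|gyr w p|),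
      `|(V (w, p)).2 - (V (w, p)).1 - Jinv *m gyr w p| <= C * `|p - w|,
      `|gyro_rate w p| <= C * (`|p - w| + `|gyr w p|) &
      `|crossmul (mom w p) (B *m mom w p)| <=
        C * (`|p - w| + `|gyr w p|)].
Proof.
have [rho0|rhoN] := leP 0 rho; last first.
  exists 1 => // w p.
  by move/(le_trans (normr_ge0 _))/(lt_le_trans rhoN); rewrite ltxx.
have [CJ CJ0 normJ] := norm_mulmx J.
have [CI CI0 normJinv] := norm_mulmx Jinv.
have [CB CB0 normB] := norm_mulmx B.
pose m := CJ * rho + I * rho; pose s := k + 2 * I * rho.
pose c2 := k / I + 2 * rho; pose c1 := CI * (s + 1).
have m0 : 0 <= m by rewrite addr_ge0 // mulr_ge0 // ltW.
have s0 : 0 <= s by rewrite addr_ge0 ?mulr_ge0 // ltW.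
have c20 : 0 <= c2 by rewrite addr_ge0 ?divr_ge0 ?mulr_ge0 // ltW.
have c10 : 0 <= c1.
  by apply: mulr_ge0; [exact: ltW|exact: addr_ge0].
pose cq := 2 * c1 * m + 2 * rho; pose cg := 1 + 2 * I * m * CB.
have cq0 : 0 <= cq.
  by apply: addr_ge0; [apply: mulr_ge0 => //|]; exact: mulr_ge0.
have cg0 : 0 <= cg by rewrite addr_ge0 // !mulr_ge0 // ltW.
have CIs0 : 0 <= CI * s by rewrite mulr_ge0 // ltW.
pose C := 2 * rho + 2 * rho * m + c1 + c2 + CI * s + cq + cg + 1.
have rm0 : 0 <= rho * m by rewrite mulr_ge0.
exists C => [|w p hw hp]; first by rewrite /C; lra.
set z := p - w; set q := gyr w p; set M := mom w p.
have z0 : 0 <= `|z| by []; have q0 : 0 <= `|q| by [].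
have zq0 : 0 <= `|z| + `|q| by rewrite addr_ge0.
have weaken c x : 0 <= x -> c <= C -> c * x <= C * x.
  by move=> *; exact: ler_wpM2r.
have normM : `|M| <= m.
  apply: le_trans (ler_normD _ _) _; apply: lerD.
    by apply: le_trans (normJ _) _; rewrite ler_pM2l.
  by rewrite normrZ gtr0_norm // ler_pM2l.
have normz : `|z| <= 2 * rho.
  by apply: le_trans (ler_normB _ _) _; lra.
have cross_le (u v : 'cV[R]_3) a b : `|u| <= a -> `|v| <= b ->
    `|crossmul u v| <= 2 * (a * b).
  move=> ua vb; apply: le_trans (norm_crossmul _ _) _.
  by rewrite ler_pM2l // ler_pM.
have normq : `|q| <= 2 * (rho * m) by exact: cross_le.
have normwz : `|crossmul w z| <= 2 * (rho * `|z|) by exact: cross_le.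
have norms : `|k *: z + I *: crossmul w z| <= s * `|z|.
  apply: le_trans (ler_normD _ _) _; rewrite !normrZ !gtr0_norm //.
  rewrite /s mulrDl lerD2l.
  have : I * `|crossmul w z| <= I * (2 * (rho * `|z|)) by rewrite ler_pM2l.
  by lra.
have norm1 : `|(V (w, p)).1| <= c1 * (`|z| + `|q|).
  rewrite vfield1E // -/z -/q; apply: le_trans (normJinv _) _.
  rewrite /c1 -mulrA ler_pM2l // addrAC.
  apply: le_trans (ler_normB _ _) _.
  have := mulr_ge0 s0 q0; lra.
have norm2 : `|(V (w, p)).2| <= c2 * `|z|.
  rewrite vfield2E // -/z; apply: le_trans (ler_normB _ _) _.
  rewrite normrZ normrN gtr0_norm ?divr_gt0 // /c2.
  by lra.
split.
- by split; rewrite /C; lra.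
- split; first by apply: le_trans norm1 _; apply: weaken => //; rewrite /C; lra.
  apply: (@le_trans _ _ (c2 * (`|z| + `|q|))).
    by apply: le_trans norm2 _; rewrite ler_wpM2l // lerDl.
  by apply: weaken => //; rewrite /C; lra.
- have -> : (V (w, p)).2 - (V (w, p)).1 - Jinv *m q =
            (V (w, p)).2 - Jinv *m (k *: z + I *: crossmul w z).
    rewrite vfield1E // -/z -/q -addrA -opprD -mulmxDr; congr (_ - _ *m _).
    by rewrite addrAC subrK.
  apply: (@le_trans _ _ ((c2 + CI * s) * `|z|)).
    apply: le_trans (ler_normB _ _) _; rewrite mulrDl; apply: lerD => //.
    by apply: le_trans (normJinv _) _; rewrite -mulrA ler_pM2l.
  by apply: weaken => //; rewrite /C; lra.
- apply: (@le_trans _ _ (cq * (`|z| + `|q|))).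
    apply: le_trans (ler_normD _ _) _; rewrite /cq mulrDl; apply: lerD.
      by apply: le_trans (cross_le _ _ _ _ norm1 normM) _; lra.
    apply: (@le_trans _ _ (2 * (rho * `|q|))).
      by apply: cross_le; rewrite ?normrN.
    by rewrite mulrA ler_wpM2l ?mulr_ge0 // lerDr.
  by apply: weaken => //; rewrite /C; lra.
- apply: (@le_trans _ _ (cg * (`|z| + `|q|))).
    rewrite crossmul_total_inertia_inv // -/q -/M -/z.
    apply: le_trans (ler_normD _ _) _; rewrite normrN normrZ gtr0_norm //.
    have : I * `|crossmul M (B *m z)| <= I * (2 * (m * (CB * `|z|))).
      by rewrite ler_pM2l //; exact: cross_le.
    have : 0 <= 2 * I * m * CB * `|q| by rewrite !mulr_ge0 // ltW.
    by rewrite /cg; lra.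
  by apply: weaken => //; rewrite /C; lra.
Qed.

Variables w p : R -> 'cV[R]_3.
Hypothesis w_derive : forall t : R, 0 <= t -> coord_derive w t (V (w t, p t)).1.
Hypothesis p_derive : forall t : R, 0 <= t -> coord_derive p t (V (w t, p t)).2.
Variable rho : R.
Hypothesis w_le : forall t : R, 0 <= t -> `|w t| <= rho.
Hypothesis p_le : forall t : R, 0 <= t -> `|p t| <= rho.

Let z t := p t - w t.
Let q t := gyr (w t) (p t).
Let M t := mom (w t) (p t).
Let dw t := (V (w t, p t)).1.
Let dp t := (V (w t, p t)).2.
Let S t := `|z t| ^+ 2 + `|q t| ^+ 2.

Let z_derive (t : R) : 0 <= t -> coord_derive z t (dp t - dw t).
Proof.
by move=> t0; apply: coord_deriveB; [exact: p_derive|exact: w_derive].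
Qed.

Let M_derive (t : R) : 0 <= t -> coord_derive M t (- q t).
Proof.
move=> t0; rewrite -(momentum_rate k) //; apply: coord_deriveD.
  by apply: coord_derive_mulmx; exact: w_derive.
by apply: coord_deriveZ; exact: p_derive.
Qed.

Let q_derive (t : R) : 0 <= t -> coord_derive q t (gyro_rate (w t) (p t)).
Proof.
by move=> t0; apply: coord_derive_crossmul; [exact: w_derive|exact: M_derive].
Qed.

Lemma momentum_sqr_constant (t : R) :
  0 <= t -> dot (M t) (M t) = dot (M 0) (M 0).
Proof.
move=> t0; apply/eqP; rewrite -subr_eq0 -normr_eq0 eq_le normr_ge0 andbT.
have := @increment_le_of_derive_le _ (fun s => dot (M s) (M s)) (fun=> 0)
          (fun=> 0) (fun=> 0) 0 t t0; rewrite subr0; apply => s /andP[s0 _].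
- apply: is_derive_eq (is_derive_dot (M_derive s0) (M_derive s0)) _.
  by rewrite !dotE /q /crossmul !mxE /=; ring.
- by rewrite normr0.
Qed.

Let E t := energy I A1 A2 A3 (w t) (p t).

Let E_derive (t : R) : 0 <= t -> is_derive t 1 E (- (2 * k) * dot (z t) (z t)).
Proof.
move=> t0; have hw := w_derive t0; have hp := p_derive t0.
have h1 := is_derive_dot hw (coord_derive_mulmx J hw).
have h2 := is_derive_dot hp hp.
rewrite (_ : E = (fun s => dot (w s) (J *m w s))
                 + I \*: (fun s => dot (p s) (p s))) //.
have -> : - (2 * k) * dot (z t) (z t) = 2 * (- k * dot (p t - w t) (p t - w t)).
  by rewrite /z; ring.
rewrite -(energy_rate k I_gt0 A1_gt0 A12 A23).
apply: is_derive_eq; move: (V (w t, p t)) => v.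
by rewrite /GRing.scale /= !dotE !inertia_mulE; ring.
Qed.

Let S_ge0 t : 0 <= S t.
Proof. by rewrite addr_ge0 // sqr_ge0. Qed.

Let energy_ge0 t : 0 <= E t.
Proof.
have sq a x : 0 < a -> 0 <= x * (a * x) :> R.
  by move=> a0; rewrite mulrCA -expr2 mulr_ge0 ?sqr_ge0 // ltW.
rewrite /E /energy [dot (w t) _]dotE !inertia_mulE; apply: addr_ge0.
  by rewrite !addr_ge0 // sq.
apply: mulr_ge0; first exact: ltW.
by apply: le_trans (sqr_norm_le_dot _); exact: sqr_ge0.
Qed.

Lemma dot_Jinv_ge (u : 'cV[R]_3) : A3^-1 * `|u| ^+ 2 <= dot (Jinv *m u) u.
Proof.
apply: (@le_trans _ _ (A3^-1 * dot u u)).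
  by rewrite ler_pM2l ?invr_gt0 // sqr_norm_le_dot.
have le_inv A x : 0 < A -> A <= A3 -> A3^-1 * (x * x) <= A^-1 * x * x.
  by move=> A0 AA; rewrite -mulrA ler_wpM2r -?expr2 ?sqr_ge0 // lef_pV2.
rewrite !dotE !JinvE // !mulrDr.
by rewrite !lerD // le_inv // (le_trans A12).
Qed.

(** The left-hand side is the derivative of energy - e (z . q). *)
Lemma trajectory_lyapunov : exists e c0, [/\ 0 < e, 0 < c0 &
  forall t, 0 <= t -> - (2 * k) * dot (z t) (z t)
    - e * (dot (dp t - dw t) (q t) + dot (z t) (gyro_rate (w t) (p t)))
    <= - c0 * S t].
Proof.
have [C C0 bd] := rate_bounds rho.
have k2 : 0 < 2 * k by rewrite mulr_gt0.
have a0 : 0 < A3^-1 by rewrite invr_gt0.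
have C6 : 0 < 6 * C by rewrite mulr_gt0.
have [e [c0 [e0 c00 absorb]]] := cross_term_absorbed k2 a0 C6.
exists e, c0; split=> // t t0; apply: le_trans (absorb _ _).
have [_ _ hr hg _] := bd _ _ (w_le t0) (p_le t0).
rewrite -/(z t) -/(q t) -/(dp t) -/(dw t) in hr hg.
set x := `|z t| in hr hg *; set y := `|q t| in hr hg *.
have x0 : 0 <= x by exact: normr_ge0.
have y0 : 0 <= y by exact: normr_ge0.
have h1 : x ^+ 2 <= dot (z t) (z t) by exact: sqr_norm_le_dot.
have h2 : A3^-1 * y ^+ 2 - 3 * (C * x * y) <= dot (dp t - dw t) (q t).
  set r := dp t - dw t - Jinv *m q t in hr.
  have -> : dot (dp t - dw t) (q t) = dot (Jinv *m q t) (q t) + dot r (q t).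
    by rewrite /r [in RHS]dotBl [RHS]addrC subrK.
  apply: lerD; first exact: dot_Jinv_ge.
  have := norm_dot r (q t); rewrite ler_norml => /andP[+ _]; apply: le_trans.
  by rewrite lerN2 ler_pM2l // ler_wpM2r.
have h3 : - (3 * (x * (C * (x + y)))) <= dot (z t) (gyro_rate (w t) (p t)).
  have := norm_dot (z t) (gyro_rate (w t) (p t)).
  rewrite ler_norml => /andP[+ _]; apply: le_trans.
  by rewrite lerN2 ler_pM2l // ler_wpM2l.
have h4 : k * x ^+ 2 <= k * dot (z t) (z t) by rewrite ler_pM2l.
have h5 : 0 <= C * x ^+ 2 by rewrite mulr_ge0 ?sqr_ge0 // ltW.
have h6 : e * (A3^-1 * y ^+ 2 - 6 * C * (x * y) - 6 * C * x ^+ 2) <=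
    e * (dot (dp t - dw t) (q t) + dot (z t) (gyro_rate (w t) (p t))).
  by rewrite ler_pM2l //; lra.
lra.
Qed.

(** The function H = E - e (z . q) fulfils the hypotheses of
exponential_convergence. For the Lojasiewicz hypothesis at a level h: H differs
from the form F in the momentum by O(S). If S is small, then F is as close to h
as H is, and the inequality for F applies; if S is not small, the inequality
holds because H - h is bounded. That the limit is an equilibrium follows from
evaluating the field at late times when S is small; that it has zero slip, from
energy_rate. *)
Lemma trajectory_convergence : exists t0 c C, [/\ 0 <= t0, 0 < c, 0 < C &
  exists l : 'cV[R]_3, V (l, l) = 0 /\ forall t : R, t0 <= t -> forall i,
    `|w t i 0 - l i 0| <= C * expR (- c * t) /\
    `|p t i 0 - l i 0| <= C * expR (- c * t)].
Proof.
have [C C0 bd] := rate_bounds rho.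
have [e [c0 [e0 c00 decay]]] := trajectory_lyapunov.
pose H t := E t - e * dot (z t) (q t).
pose dH t := - (2 * k) * dot (z t) (z t)
    - e * (dot (dp t - dw t) (q t) + dot (z t) (gyro_rate (w t) (p t))).
have H_derive (t : R) : 0 <= t -> is_derive t 1 H (dH t).
  move=> t0; have h1 := E_derive t0.
  have h2 := is_derive_dot (z_derive t0) (q_derive t0).
  rewrite (_ : H = E - e \*: (fun s => dot (z s) (q s))) //.
  exact: is_derive_eq.
have zq_le t : `|dot (z t) (q t)| <= 3 * S t.
  apply: le_trans (norm_dot _ _) _; rewrite ler_pM2l // /S.
  have := sqr_ge0 (`|z t| - `|q t|); have := S_ge0 t; rewrite /S; lra.
have H_ge (t : R) : 0 <= t -> - (3 * e * C ^+ 2) <= H t.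
  move=> t0; have [[hz hq] _ _ _ _] := bd _ _ (w_le t0) (p_le t0).
  have zq : dot (z t) (q t) <= 3 * (C * C).
    apply: le_trans (ler_norm _) _; apply: le_trans (norm_dot _ _) _.
    by rewrite ler_pM2l // ler_pM.
  have : e * dot (z t) (q t) <= e * (3 * (C * C)) by rewrite ler_pM2l.
  by have := energy_ge0 t; rewrite /H; lra.
have lojasiewicz h : exists d kappa, [/\ 0 < d, 0 < kappa &
    forall t : R, 0 <= t -> `|H t - h| <= d -> H t - h <= kappa * S t].
  have [CK CK0 normK] := norm_mulmx (J *m B).
  have [d [CF [d0 CF0 loja]]] := quadratic_form_lojasiewicz
    (A1 + I)^-1 (A2 + I)^-1 (A3 + I)^-1 (dot (M 0) (M 0)) h.
  pose C2 := 3 * e + 3 * I * CK.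
  have C20 : 0 < C2 by rewrite addr_gt0 ?mulr_gt0.
  (* C2 S bounds |H - F|, and 6 C^2 S bounds |M x B M|^2 *)
  pose kappa := C2 + CF * (6 * C ^+ 2).
  have kappa0 : 0 < kappa by rewrite addr_gt0 // !mulr_gt0 // exprn_gt0.
  have C2k : C2 <= kappa by rewrite lerDl !mulr_ge0 ?sqr_ge0 // ltW.
  exists (d / 2), kappa; split=> // [|t t0 Hh]; first by rewrite divr_gt0.
  have [[hz hq] _ _ _ hg] := bd _ _ (w_le t0) (p_le t0).
  rewrite -/(z t) -/(q t) -/(M t) in hz hq hg.
  have C2S : C2 * S t <= kappa * S t by rewrite ler_wpM2r.
  pose F := dot (M t) (B *m M t).
  have HF : `|H t - F| <= C2 * S t.
    have -> : H t - F = I * dot (z t) (J *m (B *m z t)) - e * dot (z t) (q t).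
      by rewrite /H /E energy_split // -/(M t) -/(z t) -/F; ring.
    apply: le_trans (ler_normB _ _) _.
    rewrite !normrM (gtr0_norm I_gt0) (gtr0_norm e0) addrC.
    rewrite /C2 mulrDl; apply: lerD.
      by rewrite -mulrA mulrCA ler_pM2l.
    rewrite [3 * I]mulrC -!mulrA ler_pM2l //.
    apply: le_trans (norm_dot _ _) _; rewrite ler_pM2l // mulmxA.
    have : `|z t| * `|J *m B *m z t| <= `|z t| * (CK * `|z t|).
      by rewrite ler_wpM2l.
    have : 0 <= CK * `|q t| ^+ 2 by rewrite mulr_ge0 ?sqr_ge0 // ltW.
    by rewrite /S; lra.
  (* where S is not small, H - h <= d / 2 is already below C2 S *)
  have [small|large] := leP (C2 * S t) (d / 2); last first.
    by have := ler_norm (H t - h); lra.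
  have Fh : `|F - h| <= d.
    by have := ler_distD (H t) F h; rewrite (distrC F (H t)); lra.
  have {Fh} := loja (M t) (momentum_sqr_constant t0) Fh.
  rewrite -/F; set g := dot (crossmul _ _) _ => Fh.
  have gS : g <= 6 * C ^+ 2 * S t.
    apply: (@le_trans _ _ (3 * (C * (`|z t| + `|q t|)) ^+ 2)).
      apply: le_trans (ler_norm _) _; apply: le_trans (norm_dot _ _) _.
      rewrite ler_pM2l // -expr2 ler_pXn2r ?nnegrE //.
      by apply: mulr_ge0; [exact: ltW|exact: addr_ge0].
    have := mulr_ge0 (sqr_ge0 C) (sqr_ge0 (`|z t| - `|q t|)).
    by rewrite /S; lra.
  have : CF * g <= CF * (6 * C ^+ 2 * S t) by rewrite ler_pM2l.
  have := ler_norm (H t - F); have := ler_norm (F - h).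
  by rewrite /kappa; lra.
have S_small := dissipation_small c00 H_derive decay H_ge.
have [t0 [c [t00 c_gt0 conv]]] := exponential_convergence c00 H_derive
  (fun t _ => S_ge0 t) decay H_ge lojasiewicz.
have K0 : 0 < 2 * C by rewrite mulr_gt0.
have [D D0 {}conv] := conv _ K0.
have rate_le (t : R) (v : 'cV[R]_3) i : `|v| <= C * (`|z t| + `|q t|) ->
    v i 0 ^+ 2 <= (2 * C) ^+ 2 * S t.
  move=> hv; apply: (@le_trans _ _ ((C * (`|z t| + `|q t|)) ^+ 2)).
    rewrite -(@real_normK _ (v i 0)) ?num_real // ler_pXn2r ?nnegrE //.
      exact: le_trans (normcv_coord _ _) hv.
    by apply: mulr_ge0; [exact: ltW|exact: addr_ge0].
  have := mulr_ge0 (sqr_ge0 C) (sqr_ge0 (`|z t| - `|q t|)).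
  have := mulr_ge0 (sqr_ge0 C) (S_ge0 t).
  by rewrite /S; lra.
have /choice[lw hlw] i : exists l, forall t : R, t0 <= t ->
    `|w t i 0 - l| <= D * expR (- c * t).
  apply: (conv (fun t => w t i 0) (fun t => dw t i 0)) => t t_ge0.
    exact: w_derive.
  by apply: rate_le; have [_ []] := bd _ _ (w_le t_ge0) (p_le t_ge0).
have /choice[lp hlp] i : exists l, forall t : R, t0 <= t ->
    `|p t i 0 - l| <= D * expR (- c * t).
  apply: (conv (fun t => p t i 0) (fun t => dp t i 0)) => t t_ge0.
    exact: p_derive.
  by apply: rate_le; have [_ []] := bd _ _ (w_le t_ge0) (p_le t_ge0).
pose x t := col_mx (w t) (p t); pose L := col_mx (\col_i lw i) (\col_i lp i).
have xL (t : R) : t0 <= t -> `|L - x t| <= D * expR (- c * t).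
  move=> tt; rewrite distrC; apply: normcv_le => [|i].
    by rewrite mulr_ge0 ?expR_ge0 // ltW.
  case: (split_ordP i) => j ->.
    by rewrite mxE [X in _ + X]mxE !col_mxEu mxE; exact: hlw.
  by rewrite mxE [X in _ + X]mxE !col_mxEd mxE; exact: hlp.
have col_le (u v : 'cV[R]_3) b : 0 <= b -> `|u| <= b -> `|v| <= b ->
    `|col_mx u v| <= b.
  move=> b0 ub vb; apply: normcv_le => // i; case: (split_ordP i) => j ->.
    by rewrite col_mxEu; exact: le_trans (normcv_coord _ _) ub.
  by rewrite col_mxEd; exact: le_trans (normcv_coord _ _) vb.
have field0 : state_field k I A1 A2 A3 L = 0.
  have [G G0 field_lip] :=
    @state_field_locally_lipschitz _ k I A1 A2 A3 (rho + D).
  apply/eqP; rewrite -normr_eq0 eq_le normr_ge0 andbT leNgt; apply/negP.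
  set Y := `|_| => Y0; pose Q := G * D + 2 * C.
  have Q0 : 0 < Q by rewrite addr_gt0 ?mulr_gt0.
  pose eta := Y / (2 * Q).
  have eta0 : 0 < eta by rewrite divr_gt0 // mulr_gt0.
  (* past 1 / (c eta) the exponential exp(-ct) is below eta *)
  have [t [t_ge0 Tt St]] := S_small (eta ^+ 2) (Num.max t0 (1 / (c * eta)))
    (exprn_gt0 2 eta0).
  have [tt te] : t0 <= t /\ 1 / (c * eta) <= t.
    by move: Tt; rewrite ge_max => /andP.
  have exp_le : expR (- c * t) <= eta.
    rewrite mulNr expRN -[leRHS]invrK lef_pV2 ?posrE ?expR_gt0 ?invr_gt0 //.
    apply: le_trans (expR_ge1Dx _).
    have : c * (1 / (c * eta)) <= c * t by rewrite ler_pM2l.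
    have -> : c * (1 / (c * eta)) = eta^-1 by field; rewrite !lt0r_neq0.
    lra.
  have exp_le1 : expR (- c * t) <= 1.
    by rewrite -expR0 ler_expR mulNr oppr_le0 mulr_ge0 // ltW.
  have sq_lt a b : 0 <= a -> 0 <= b -> a ^+ 2 + b ^+ 2 < eta ^+ 2 -> a <= eta.
    move=> a0 b0 ab; rewrite -(@ler_pXn2r _ 2) ?nnegrE ?(ltW eta0) //.
    by have := sqr_ge0 b; lra.
  have z_le : `|z t| <= eta by apply: sq_lt St.
  have q_le : `|q t| <= eta by apply: (sq_lt _ `|z t|) => //; rewrite addrC.
  have rho0 : 0 <= rho by apply: le_trans (w_le t_ge0).
  have x_le : `|x t| <= rho by apply: col_le; [|exact: w_le|exact: p_le].
  have D_exp : D * expR (- c * t) <= D by rewrite ler_piMr // ltW.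
  have L_le : `|L| <= rho + D.
    rewrite -(subrK (x t) L) addrC; apply: le_trans (ler_normD _ _) _.
    by apply: lerD => //; exact: le_trans (xL t tt) D_exp.
  have x_le' : `|x t| <= rho + D by rewrite (le_trans x_le) // lerDl ltW.
  have field_x : `|state_field k I A1 A2 A3 (x t)| <= C * (2 * eta).
    have [_ [h1 h2] _ _ _] := bd _ _ (w_le t_ge0) (p_le t_ge0).
    have zq : C * (`|z t| + `|q t|) <= C * (2 * eta).
      by rewrite ler_pM2l //; lra.
    rewrite /state_field /x col_mxKu col_mxKd; apply: col_le.
    - by apply: mulr_ge0; [|apply: mulr_ge0 => //]; exact: ltW.
    - exact: le_trans h1 zq.
    - exact: le_trans h2 zq.
  have h1 := field_lip _ _ L_le x_le'; have h2 := xL t tt.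
  have h3 : G * `|L - x t| <= G * (D * eta).
    rewrite ler_pM2l //; apply: le_trans h2 _; by rewrite ler_pM2l.
  have := ler_normD
    (state_field k I A1 A2 A3 L - state_field k I A1 A2 A3 (x t))
    (state_field k I A1 A2 A3 (x t)).
  rewrite subrK -/Y => h4.
  have : Q * eta = Y / 2 by rewrite /eta; field; rewrite lt0r_neq0.
  rewrite /Q; lra.
pose l : 'cV[R]_3 := \col_i lw i; pose l' : 'cV[R]_3 := \col_i lp i.
have V0 : V (l, l') = 0.
  have : col_mx (V (l, l')).1 (V (l, l')).2 = 0.
    by have := field0; rewrite /state_field /L col_mxKu col_mxKd.
  by rewrite -col_mx0 => /eq_col_mx[]; case: (V _) => /= ? ? -> ->.
have ll' : l' = l.
  have := energy_rate k I_gt0 A1_gt0 A12 A23 l l'; rewrite V0 /= mulmx0.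
  have -> : dot l 0 + I * dot l' 0 = 0 by rewrite !dotE !mxE; ring.
  move/esym/eqP; rewrite mulf_eq0 oppr_eq0 (gt_eqF k_gt0) /= => /eqP d0.
  apply/eqP; rewrite -subr_eq0 -normr_eq0 -sqrf_eq0 eq_le sqr_ge0 andbT -d0.
  exact: sqr_norm_le_dot.
exists t0, c, D; split=> //; exists l; split; first by rewrite -{2}ll'.
move=> t tt i; split; first by rewrite mxE; exact: hlw.
by rewrite -ll' mxE; exact: hlp.
Qed.

End Trajectory.

(** * One-sided derivatives *)

(** Brings the two-sided derivative to the same form as the derivative relative
to a set in has_derivative_within_slopeP. *)
Lemma is_derive_slopeP (R : realType) (u : R -> R) (t d : R) :
  is_derive t 1 u d <->
  forall e, 0 < e -> \forall s \near t^', `|d - (s - t)^-1 * (u s - u t)| <= e.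
Proof.
have -> : is_derive t 1 u d <->
    (fun h => h^-1 *: ((u \o shift t) (h *: 1) - u t)) @ 0^' --> d.
  split=> [[ex <-] //|ud]; apply: DeriveDef; first by apply/cvg_ex; exists d.
  exact/cvg_lim.
have slope h : h^-1 *: ((u \o shift t) (h *: 1) - u t) =
               h^-1 * (u (h + t) - u t) by rewrite /= [_ *: 1]mulr1.
split=> [/cvgrPdist_le ud e /ud h|ud].
  have {}h : \forall x \near (0 : R), x != 0 ->
    `|d - x^-1 *: ((u \o shift t) (x *: 1) - u t)| <= e by exact: h.
  rewrite (near_shift t 0) in h.
  suff : \forall s \near t, s != t ->
    `|d - (s - t)^-1 * (u s - u t)| <= e by [].
  apply: filterS h => s /= h st; move: h; rewrite slope sub0r addrNK; apply.
  by rewrite subr_eq0.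
apply/cvgrPdist_le => e /ud h.
have {}h : \forall s \near t, s != t -> `|d - (s - t)^-1 * (u s - u t)| <= e.
  exact: h.
rewrite (near_shift 0 t) in h.
suff : \forall x \near (0 : R), x != 0 ->
    `|d - x^-1 *: ((u \o shift t) (x *: 1) - u t)| <= e by [].
apply: filterS h => x /= h x0; move: h; rewrite slope subr0 addrK; apply.
by rewrite -subr_eq0 addrK.
Qed.

Lemma has_derivative_within_slopeP (R : realType) (V : normedModType R)
    (D : set R) (f : R -> V) (t : R) (v : V) :
  has_derivative_within D f t v <->
  forall e, 0 < e -> \forall s \near t^', D s ->
    `|v - (s - t)^-1 *: (f s - f t)| <= e.
Proof.
split=> [/cvgrPdist_le fv e /fv|fv]; first by rewrite near_withinE.
by apply/cvgrPdist_le => e /fv; rewrite near_withinE.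
Qed.

Section Pair.
Variable R : realType.
Implicit Types v : 'cV[R]_3 * 'cV[R]_3.

Lemma has_derivative_within_of_coord (D : set R) (w p : R -> 'cV[R]_3)
    (t : R) v :
  coord_derive w t v.1 -> coord_derive p t v.2 ->
  has_derivative_within D (fun s => (w s, p s)) t v.
Proof.
move=> hw hp; apply/has_derivative_within_slopeP => e e0.
have nw : \forall s \near t^', forall i,
    `|v.1 i 0 - (s - t)^-1 * (w s i 0 - w t i 0)| <= e.
  by apply: filter_forall => i; move/is_derive_slopeP: (hw i); exact.
have np : \forall s \near t^', forall i,
    `|v.2 i 0 - (s - t)^-1 * (p s i 0 - p t i 0)| <= e.
  by apply: filter_forall => i; move/is_derive_slopeP: (hp i); exact.
apply: filterS2 nw np => s nws nps _; rewrite prod_normE ge_max.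
by apply/andP; split; apply: normcv_le => [|i]; rewrite ?(ltW e0) // !mxE.
Qed.

Lemma coord_slope_of_within (D : set R) (y : R -> 'cV[R]_3 * 'cV[R]_3)
    (t : R) v :
  has_derivative_within D y t v -> forall i e, 0 < e ->
  (\forall s \near t^', D s ->
     `|v.1 i 0 - (s - t)^-1 * ((y s).1 i 0 - (y t).1 i 0)| <= e) /\
  (\forall s \near t^', D s ->
     `|v.2 i 0 - (s - t)^-1 * ((y s).2 i 0 - (y t).2 i 0)| <= e).
Proof.
move=> /has_derivative_within_slopeP yv i e /yv near_yv.
split; apply: filterS near_yv => s near_yv /near_yv;
  rewrite prod_normE ge_max => /andP[h1 h2].
- by have := le_trans (normcv_coord _ i) h1; rewrite !mxE.
- by have := le_trans (normcv_coord _ i) h2; rewrite !mxE.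
Qed.

End Pair.

(** With d the one-sided derivative at 0, the extension has a two-sided
derivative at 0, so that the uniqueness statement applies to solutions with a
one-sided derivative at the initial time. *)
Definition extend_left (R : realType) (d : R) (u : R -> R) (s : R) : R :=
  if 0 <= s then u s else u 0 + s * d.

Lemma is_derive_extend_left (R : realType) (u : R -> R) (d0 d t T : R) :
  0 <= t -> t < T -> (t = 0 -> d = d0) ->
  (forall e, 0 < e -> \forall s \near t^', `[0, T[%classic s ->
     `|d - (s - t)^-1 * (u s - u t)| <= e) ->
  is_derive t 1 (extend_left d0 u) d.
Proof.
move=> t0 tT dd0 slope; apply/is_derive_slopeP => e e0.
have near_T : \forall s \near t^', s < T by apply: nbhs_dnbhs; exact: lt_nbhsl.
have near_0 : \forall s \near t^', 0 < t -> 0 < s.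
  have [lt0t|_] := ltP 0 t; last exact: nearW.
  by apply: nbhs_dnbhs; apply: filterS (lt_nbhsr lt0t).
have near_ne : \forall s \near t^', s != t by exact: nbhs_dnbhs_neq.
near=> s; rewrite /extend_left t0.
have sT : s < T by near: s.
have s0 : 0 < t -> 0 < s by near: s.
have st : s != t by near: s.
have [s_ge0|s_lt0] := leP 0 s.
  have : `[0, T[%classic s by rewrite /= in_itv /= s_ge0.
  by near: s; exact: slope.
have tE : t = 0.
  apply/eqP; rewrite eq_le t0 andbT leNgt; apply/negP => /s0.
  by rewrite ltNge ltW.
have s_ne0 : s != 0 by rewrite -tE.
by rewrite (dd0 tE) tE subr0 [_ + _ - _]addrC addKr mulKf // subrr normr0 ltW.
Unshelve. all: by end_near. Qed.

(** * Convergence of every solution *)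

Theorem theorem13 (R : realType) (k I A1 A2 A3 : R)
    (k_gt0 : 0 < k) (I_gt0 : 0 < I)
    (A1_gt0 : 0 < A1) (A12 : A1 <= A2) (A23 : A2 <= A3)
    (Omega0 Omega10 : 'cV[R]_3) :
  let J := inertia A1 A2 A3 in
  exists (tstar : R) (Omegastar Omega1star : 'cV[R]_3),
    [/\ 0 <= tstar,
        equilibria k I J (Omegastar, Omega1star) &
        exists x : R -> 'cV[R]_3 * 'cV[R]_3,
          [/\ is_solution k I J (Omega0, Omega10) `[0, +oo[ x,
              (forall (T : R) (y : R -> 'cV[R]_3 * 'cV[R]_3),
                 is_solution k I J (Omega0, Omega10) `[0, T[ y ->
                 forall t, 0 <= t < T -> y t = x t) &
              exists C c : R,
                [/\ 0 < C, 0 < c &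
                    forall t, tstar <= t ->
                      enorm ((x t).1 - Omegastar) + enorm ((x t).2 - Omegastar)
                        <= C * expR (- c * t)]]].
Proof.
move=> J.
have A2_gt0 : 0 < A2 by exact: lt_le_trans A12.
have A3_gt0 : 0 < A3 by exact: lt_le_trans A23.
pose a := energy_weight I A1 A2 A3; pose f := state_field k I A1 A2 A3.
have a_gt0 : forall i, 0 < a i by exact: energy_weight_gt0.
have f_lip : locally_lipschitz f by exact: state_field_locally_lipschitz.
have f_dis (x : 'cV[R]_(3 + 3)) : \sum_i a i * (x i 0 * f x i 0) <= 0.
  exact: state_field_dissipative.
pose x0 := col_mx Omega0 Omega10.
have [X [X0 dX]] := dissipative_ode_exists a_gt0 f_lip f_dis x0.
pose w t := usubmx (X t); pose p t := dsubmx (X t).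
have dw (t : R) : 0 <= t -> coord_derive w t (vfield k I J (w t, p t)).1.
  move=> t0 i; have := dX t t0 (lshift 3 i); rewrite /f /state_field col_mxEu.
  rewrite (_ : (fun s => X s _ _) = (fun s => w s i 0)) //.
  by apply/funext => s; rewrite mxE.
have dp (t : R) : 0 <= t -> coord_derive p t (vfield k I J (w t, p t)).2.
  move=> t0 i; have := dX t t0 (rshift 3 i); rewrite /f /state_field col_mxEd.
  rewrite (_ : (fun s => X s _ _) = (fun s => p s i 0)) //.
  by apply/funext => s; rewrite mxE.
have [rho rho0 bound] := dissipative_bound a_gt0 x0.
have X_le (t : R) : 0 <= t -> `|X t| <= rho.
  by move=> t0; apply: (bound X (f \o X)) => // s /andP[s0 _]; exact: dX.
have w_le (t : R) : 0 <= t -> `|w t| <= rho.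
  move=> t0; apply: le_trans (X_le t t0); apply: normcv_le => // i.
  by rewrite mxE normcv_coord.
have p_le (t : R) : 0 <= t -> `|p t| <= rho.
  move=> t0; apply: le_trans (X_le t t0); apply: normcv_le => // i.
  by rewrite mxE normcv_coord.
have [t0 [c [C [t0_ge0 c_gt0 C_gt0 [l [Vl conv]]]]]] :=
  trajectory_convergence k_gt0 I_gt0 A1_gt0 A12 A23 dw dp w_le p_le.
exists t0, l, l; split=> //; exists (fun t => (w t, p t)); split.
- split=> [|t]; first by rewrite /w /p X0 col_mxKu col_mxKd.
  rewrite /= in_itv /= andbT => t_ge0.
  by apply: has_derivative_within_of_coord; [exact: dw|exact: dp].
- move=> T y [y0 dy] t /andP[t_ge0 tT].
  pose v0 := vfield k I J (Omega0, Omega10).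
  pose Y s := col_mx (\col_i extend_left (v0.1 i 0) (fun r => (y r).1 i 0) s)
                     (\col_i extend_left (v0.2 i 0) (fun r => (y r).2 i 0) s).
  have YE s : 0 <= s -> Y s = col_mx (y s).1 (y s).2.
    move=> s0; rewrite /Y /extend_left s0.
    by congr col_mx; apply/colP => i; rewrite mxE.
  have dY s : 0 <= s <= t -> coord_derive Y s (f (Y s)).
    move=> /andP[s0 st]; have sT : s < T := le_lt_trans st tT.
    have := dy s; rewrite /= in_itv /= s0 sT => /(_ isT).
    move/coord_slope_of_within => slope.
    have v_eq : s = 0 -> vfield k I J (y s) = v0 by move=> ->; rewrite y0.
    rewrite YE // /f /state_field col_mxKu col_mxKd -surjective_pairing => i.
    case: (split_ordP i) => j ->.
      rewrite col_mxEu (_ : (fun r => Y r _ _) =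
        extend_left (v0.1 j 0) (fun r => (y r).1 j 0)); last first.
        by apply/funext => r; rewrite col_mxEu mxE.
      apply: (is_derive_extend_left s0 sT) => [/v_eq -> //|e e0].
      by have [] := slope j e e0.
    rewrite col_mxEd (_ : (fun r => Y r _ _) =
      extend_left (v0.2 j 0) (fun r => (y r).2 j 0)); last first.
      by apply/funext => r; rewrite col_mxEd mxE.
    apply: (is_derive_extend_left s0 sT) => [/v_eq -> //|e e0].
    by have [] := slope j e e0.
  have XY : X t = Y t.
    apply: (dissipative_ode_unique a_gt0 f_lip f_dis t_ge0) => //.
      by rewrite X0 YE // y0.
    by move=> s /andP[s0 _]; exact: dX.
  by rewrite /w /p XY YE // col_mxKu col_mxKd -surjective_pairing.
- exists (6 * C), c; split=> // [|t tt]; first by rewrite mulr_gt0.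
  have -> : 6 * C * expR (- c * t) =
            3 * (C * expR (- c * t)) + 3 * (C * expR (- c * t)) by ring.
  apply: lerD; apply: enorm_le => i; have [hw hp] := conv t tt i.
  - by rewrite /= mxE [X in _ + X]mxE.
  - by rewrite /= mxE [X in _ + X]mxE.
Qed.
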